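(* Define $$\Lambda_{1} := \begin{cases}2\frac{\beta_1^2+\lambda^2 \beta_2^2}{\beta_0} + \frac{L\,T^{1-\alpha}}{\beta_0\Gamma(2-\alpha)} &\text{for the fully implicit method,} \\[4pt] 2\frac{\beta_1^2+2\lambda^2 \beta_2^2((1+\mu)^2+\mu^2)}{\beta_0} + \frac{L\,T^{1-\alpha}}{\beta_0\Gamma(2-\alpha)} &\text{for the implicit-explicit (IMEX) method,}\end{cases}$$ $\mu:=\max_{2\leq n \leq N}\mu_n$ and $C_{1}:=\max\left\{\sqrt{\frac{\gamma_{0}}{\beta_{0}}},\ \sqrt{\frac{2T^\alpha}{\beta_{0}}}\right\}$. Assume $\Delta t:=\max_{1\le n\le N}\Delta t_n<\left(\frac{1}{2\Lambda_1\Gamma(2-\alpha)}\right)^{1/\alpha}$. Then the solution $u_h^n$ of the fully discrete problem $$u_h^0=P_hu_0,\qquad (D^{\alpha}_{t_n}u_h^n, v_h) + a(t_n;u_h^n,v_h) = \lambda(\mathcal{I}(Eu_h^n),v_h) +(f^n,v_h) \quad \forall v_h \in S_h,\ 1\leq n \leq N,$$ satisfies $$\|u_h^n\|_{1}\leq 2C_{1}E_{\alpha}\left(2\Lambda_{1}t_n^{\alpha}\right)\left(\|u_h^0\|_{1} + \max_{1 \leq j \leq n }\|f^j\|\right),\quad 1\leq n \leq N.$$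
   Context: **Setting.** $0<\alpha<1$, $0<T<\infty$, $J=(0,T]$, $\lambda\in\mathbb{R}$; $\Omega\subset\mathbb{R}^d$ ($d=1,2,3$) is a bounded convex polygonal or polyhedral domain. $\|\cdot\|$, $(\cdot,\cdot)$ are the $L^2(\Omega)$ norm and inner product, $\|\cdot\|_1$ the $H^1(\Omega)$ norm. $\mathcal{I}\phi(\boldsymbol{x})=\int_\Omega \phi(\boldsymbol{y})g(\boldsymbol{x},\boldsymbol{y})\,d\boldsymbol{y}$ with $g\in L^\infty(\Omega\times\Omega)$, and $\beta_2$ is a constant with $\|\mathcal I\phi\|\le\beta_2\|\phi\|$ for $\phi\in L^2(\Omega)$. The data are $u_0$ and $f$, with $f^n=f(\cdot,t_n)\in L^2(\Omega)$. **Bilinear forms.** $a=a_0+a_1$ with $a_0(t;\phi,\psi)=(\boldsymbol A(\cdot,t)\nabla\phi,\nabla\psi)$ and $a_1(t;\phi,\psi)=(\boldsymbol b(\cdot,t)\cdot\nabla\phi+c(\cdot,t)\phi,\psi)$ on $H_0^1(\Omega)$, where $\boldsymbol A$ is symmetric, uniformly positive definite and bounded on $\Omega\times J$, and $\boldsymbol b$, $c$, $\partial_t\boldsymbol A$ are bounded ($\boldsymbol A$ is extended continuously in time to $t=0$). Constants $\gamma_0,\beta_0,\beta_1,L>0$ satisfy, for all $\phi,\psi\in H_0^1(\Omega)$ and all times $t,s$: $|a_0(t;\phi,\psi)|\le\gamma_0\|\phi\|_1\|\psi\|_1$, $a_0(t;\phi,\phi)\ge\beta_0\|\phi\|_1^2$,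 $|a_0(t;\phi,\phi)-a_0(s;\phi,\phi)|\le L|t-s|\|\phi\|_1^2$, and $|a_1(t;\phi,\psi)|\le\beta_1\|\phi\|_1\|\psi\|$. **Discretization.** $N>1$, $\gamma\ge1$, $t_n=(n/N)^\gamma T$, $\Delta t_n=t_n-t_{n-1}$, $\mu_n=\Delta t_n/\Delta t_{n-1}$ ($2\le n\le N$). $S_h$ is a finite-dimensional (finite element) subspace of $H_0^1(\Omega)$ and $P_h:L^2(\Omega)\to S_h$ is the $L^2$-projection. With $k_\beta(t)=t^{\beta-1}/\Gamma(\beta)$ and $K^{n,j}_{1-\alpha}=\frac1{\Delta t_j}\int_{t_{j-1}}^{t_j}k_{1-\alpha}(t_n-s)\,ds$, the L1 operator is $D_{t_n}^\alpha\phi^n=\sum_{j=1}^nK^{n,j}_{1-\alpha}(\phi^j-\phi^{j-1})$. The extrapolation operator is: $E\phi^n=\phi^n$ (fully implicit method), or $E\phi^1=\phi^0$ and $E\phi^n=(1+\mu_n)\phi^{n-1}-\mu_n\phi^{n-2}$ for $n\ge2$ (IMEX method). $E_\alpha(z)=\sum_{j\ge0}z^j/\Gamma(j\alpha+1)$ is the Mittag-Leffler function. *)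

(* Defs.v *)
From HB Require Import structures.
From mathcomp Require Import all_boot all_order all_algebra.
From mathcomp Require Import all_classical all_reals all_analysis.

Set Implicit Arguments.
Unset Strict Implicit.
Unset Printing Implicit Defensive.
Import Order.TTheory GRing.Theory Num.Theory.
Import numFieldNormedType.Exports.

Local Open Scope classical_set_scope.
Local Open Scope ring_scope.

(* R^d is 'cV[R]_d with the sigma-algebra generated by the coordinates
   (the Borel sigma-algebra), as in the library's instance on n.-tuple T. *)
Definition measure_cV_display : measure_display.
Proof. exact default_measure_display. Qed.

Section measurable_cV.
Context {R : realType}.
Variable n : nat.

Let coors : 'I_n -> 'cV[R]_n -> R := fun i x => x i 0.

Let cV_set0 : g_sigma_preimage coors set0.
Proof. exact: sigma_algebra0. Qed.

Let cV_setC A : g_sigma_preimage coors A -> g_sigma_preimage coors (~` A).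
Proof. exact: sigma_algebraC. Qed.

Let cV_bigcup (F : _^nat) : (forall i, g_sigma_preimage coors (F i)) ->
  g_sigma_preimage coors (\bigcup_i (F i)).
Proof. exact: sigma_algebra_bigcup. Qed.

HB.instance Definition _ := @isMeasurable.Build measure_cV_display
  'cV[R]_n (g_sigma_preimage coors) cV_set0 cV_setC cV_bigcup.

End measurable_cV.

Lemma measurable_coord_cV {R : realType} n (i : 'I_n) :
  measurable_fun [set: 'cV[R]_n] (fun x : 'cV[R]_n => x i 0).
Proof.
move=> _ Y mY; rewrite setTI; apply: sub_sigma_algebra => /=.
rewrite -bigcup_seq/=; exists i => /=; first by rewrite mem_index_enum.
by exists Y => //; rewrite setTI.
Qed.

Lemma measurable_fun_cVP {R : realType} d (T : measurableType d) n
    (f : T -> 'cV[R]_n) :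
  (forall i, measurable_fun [set: T] (fun x => f x i 0)) ->
  measurable_fun [set: T] f.
Proof.
move=> mf.
suff prefS : g_sigma_preimage (fun i => (fun x : 'cV[R]_n => x i 0) \o f)
    `<=` measurable.
  move=> _ A mA; apply: prefS.
  by rewrite g_sigma_preimage_comp; exists A.
apply: smallest_sub; first exact: sigma_algebra_measurable.
case: n => [|n] in f mf *; first by rewrite big_ord0.
rewrite -bigcup_mkord_ord; apply: bigcup_sub => i Ii.
by move=> A [B mB <-]; exact: mf.
Qed.

Section lebesgue_cV_ext.
Context {R : realType} (n : nat).

Definition cons_cV (p : R * 'cV[R]_n) : 'cV[R]_n.+1 :=
  col_mx (p.1%:M : 'cV_1) p.2.

Definition uncons_cV (x : 'cV[R]_n.+1) : R * 'cV[R]_n :=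
  (x ord0 0, \col_i x (lift ord0 i) 0).

Lemma cons_cVK : cancel cons_cV uncons_cV.
Proof.
move=> [a v]; rewrite /uncons_cV /cons_cV /=; congr pair.
  have -> : (ord0 : 'I_n.+1) = lshift n (ord0 : 'I_1) by exact/val_inj.
  by rewrite (@col_mxEu _ 1 n 1) mxE eqxx.
apply/matrixP => i j; rewrite ord1 mxE.
have -> : lift ord0 i = rshift 1 i :> 'I_n.+1 by exact/val_inj.
by rewrite (@col_mxEd _ 1 n 1).
Qed.

Lemma measurable_cons_cV : measurable_fun [set: R * 'cV[R]_n] cons_cV.
Proof.
apply: measurable_fun_cVP => i.
case: (unliftP ord0 i) => [j ->|->].
  rewrite (_ : (fun _ => _) = (fun x : 'cV[R]_n => x j 0) \o snd).
    by apply: measurableT_comp => //; exact: measurable_coord_cV.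
  by apply/funext => p /=; rewrite -[in RHS](cons_cVK p) /= mxE.
rewrite (_ : (fun _ => _) = fst) //.
by apply/funext => p /=; rewrite -[in RHS](cons_cVK p).
Qed.

Lemma measurable_uncons_cV : measurable_fun [set: 'cV[R]_n.+1] uncons_cV.
Proof.
apply/measurable_fun_pairP; split; first exact: measurable_coord_cV.
apply: measurable_fun_cVP => i.
rewrite (_ : (fun _ => _) = (fun x : 'cV[R]_n.+1 => x (lift ord0 i) 0)).
  exact: measurable_coord_cV.
by apply/funext => x /=; rewrite mxE.
Qed.

Variable mu : {sigma_finite_measure set 'cV[R]_n -> \bar R}.

Let base : {measure set (measurableTypeR R * 'cV[R]_n)%type -> \bar R} :=
  (@lebesgue_measure R \x mu)%E.

Definition lebesgue_cV_ext : set 'cV[R]_n.+1 -> \bar R := pushforward base cons_cV.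

Let mpre A : measurable A -> measurable (cons_cV @^-1` A).
Proof. by move=> mA; rewrite -[X in measurable X]setTI; exact: measurable_cons_cV. Qed.

Let ext0 : lebesgue_cV_ext set0 = 0%E.
Proof. by rewrite /lebesgue_cV_ext /pushforward preimage_set0 measure0. Qed.

Let ext_ge0 A : (0 <= lebesgue_cV_ext A)%E.
Proof. exact: (measure_ge0 base). Qed.

Let ext_sigma_additive : semi_sigma_additive lebesgue_cV_ext.
Proof.
move=> F mF tF mUF; rewrite /lebesgue_cV_ext /pushforward preimage_bigcup.
apply: measure_semi_sigma_additive.
- by move=> k; exact: mpre.
- apply/trivIsetP => /= i j _ _ ij; rewrite -preimage_setI.
  by move/trivIsetP : tF => /(_ _ _ _ _ ij) ->//; rewrite preimage_set0.
- by rewrite -preimage_bigcup; exact: mpre.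
Qed.

HB.instance Definition _ :=
  isMeasure.Build _ _ _ lebesgue_cV_ext ext0 ext_ge0 ext_sigma_additive.

Let ext_sigma_finite : sigma_finite setT lebesgue_cV_ext.
Proof.
have /sigma_finiteP[F [TF ndF Foo]] := sigma_finiteT (@lebesgue_measure R).
have /sigma_finiteP[G [TG ndG Goo]] := sigma_finiteT mu.
exists (fun k => uncons_cV @^-1` (F k `*` G k)).
  rewrite -preimage_bigcup (_ : \bigcup_k _ = setT) ?preimage_setT//.
  rewrite -subTset => -[x y] _.
  have [k _ Fx] : (\bigcup_i F i) x by rewrite -TF.
  have [l _ Gy] : (\bigcup_i G i) y by rewrite -TG.
  exists (maxn k l) => //; split => /=.
  - by move: x Fx; exact/subsetPset/ndF/leq_maxl.
  - by move: y Gy; exact/subsetPset/ndG/leq_maxr.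
move=> k; have [mF Fk] := Foo k; have [mG Gk] := Goo k; split.
  rewrite -[X in measurable X]setTI; apply: measurable_uncons_cV => //.
  exact: measurableX.
rewrite /lebesgue_cV_ext /pushforward -comp_preimage (_ : _ \o _ = id) ?preimage_id; last first.
  by apply/funext => p /=; exact: cons_cVK.
by rewrite /base /= product_measure1E// lte_mul_pinfty// ge0_fin_numE.
Qed.

HB.instance Definition _ :=
  Measure_isSigmaFinite.Build _ _ _ lebesgue_cV_ext ext_sigma_finite.

Definition lebesgue_cV_succ : {sigma_finite_measure set 'cV[R]_n.+1 -> \bar R} :=
  lebesgue_cV_ext.

End lebesgue_cV_ext.

(* d-dimensional Lebesgue measure, as an iterated product measure. *)
Fixpoint lebesgue_cV {R : realType} (d : nat) :
    {sigma_finite_measure set 'cV[R]_d -> \bar R} :=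
  if d is k.+1 then lebesgue_cV_succ (lebesgue_cV k) else dirac (0 : 'cV[R]_0).

(* A pair of a function on R^d and a vector field on R^d, meant as (phi, grad phi)
   with both components taken up to null sets.  An element of H^1 is carried
   together with its (a.e. unique) weak gradient, so that linear combinations of
   elements of H^1 are the pointwise ones in this lmodType. *)
Notation fgrad R d := (('cV[R]_d -> R^o) * ('cV[R]_d -> 'cV[R]_d))%type.

Section Domain.
Context {R : realType} {d : nat}.
Implicit Types (Om : set 'cV[R]_d) (x y : 'cV[R]_d).

Definition dotv x y : R := \sum_(i < d) x i 0 * y i 0.

(* Bounded convex polytopal domain, as an intersection of open half-spaces:
   an interval, a convex polygon or a convex polyhedron for d = 1, 2, 3. *)
Definition convex_polytopal_domain Om :=
  [/\ Om !=set0, bounded_set Om &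
    exists (m : nat) (nu : 'I_m -> 'cV[R]_d) (kappa : 'I_m -> R),
      Om = [set x | forall k, dotv (nu k) x < kappa k]].

Definition partial (i : 'I_d) (eta : 'cV[R]_d -> R^o) : 'cV[R]_d -> R^o :=
  fun x => 'D_(delta_mx i 0) eta x.

Definition iter_partial (s : seq 'I_d) (eta : 'cV[R]_d -> R^o) :=
  foldr partial eta s.

Definition smooth (eta : 'cV[R]_d -> R^o) :=
  forall s : seq 'I_d, continuous (iter_partial s eta) /\
    forall (i : 'I_d) x, derivable (iter_partial s eta) x (delta_mx i 0).

(* C_c^oo(Om), extended by 0 outside Om *)
Definition test_function Om (eta : 'cV[R]_d -> R^o) :=
  smooth eta /\
  exists K : set 'cV[R]_d,
    [/\ compact K, K `<=` Om & forall x, ~ K x -> eta x = 0].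

Definition with_gradient (eta : 'cV[R]_d -> R^o) : fgrad R d :=
  (eta, fun x => \col_i partial i eta x).

End Domain.

Section Sobolev.
Context {R : realType} {d : nat} (Om : set 'cV[R]_d).
Local Notation leb := (@lebesgue_cV R d).
Implicit Types (f g : 'cV[R]_d -> R) (phi psi : fgrad R d).

Definition inL2 f :=
  measurable_fun Om f /\ leb.-integrable Om (fun x => (f x ^+ 2)%:E).

Definition ipL2 f g : R := \int[leb]_(x in Om) (f x * g x).

Definition normL2 f : R := Num.sqrt (ipL2 f f).

Definition inH1 phi :=
  [/\ inL2 phi.1,
      forall i, inL2 (fun x => phi.2 x i 0) &
      forall i eta, test_function Om eta ->
        ipL2 phi.1 (partial i eta) = - ipL2 (fun x => phi.2 x i 0) eta].

Definition normH1 phi : R :=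
  Num.sqrt (normL2 phi.1 ^+ 2 +
            \sum_(i < d) normL2 (fun x => phi.2 x i 0) ^+ 2).

(* H_0^1(Om) is the closure of C_c^oo(Om) in H^1(Om). *)
Definition inH01 phi :=
  inH1 phi /\
  forall eps : R, 0 < eps ->
    exists2 eta, test_function Om eta & normH1 (phi - with_gradient eta) < eps.

Definition findim_subspace_H01 (S : set (fgrad R d)) :=
  [/\ S `<=` inH01,
      S 0,
      forall (a : R) phi psi, S phi -> S psi -> S (a *: phi + psi) &
      exists (m : nat) (e : 'I_m -> fgrad R d), (forall i, S (e i)) /\
        forall phi, S phi -> exists a : 'I_m -> R,
          {ae leb, forall x, Om x ->
             phi.1 x = (\sum_i a i *: e i).1 x /\
             phi.2 x = (\sum_i a i *: e i).2 x}].

(* w = P_h u, the L^2-projection of u on S *)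
Definition is_L2_projection (S : set (fgrad R d)) (u : 'cV[R]_d -> R) w :=
  S w /\ forall v, S v -> ipL2 w.1 v.1 = ipL2 u v.1.

(* g is an essentially bounded function on Om x Om *)
Definition inLinf2 (g : 'cV[R]_d * 'cV[R]_d -> R) :=
  measurable_fun (Om `*` Om) g /\
  exists M : R, {ae (leb \x leb)%E, forall z, (Om `*` Om) z -> `|g z| <= M}.

Definition int_op (g : 'cV[R]_d * 'cV[R]_d -> R) f : 'cV[R]_d -> R :=
  fun x => \int[leb]_(y in Om) (f y * g (x, y)).

End Sobolev.

Section BilinearForms.
Context {R : realType} {d : nat} (Om : set 'cV[R]_d).
Variables (A : 'cV[R]_d -> R -> 'M[R]_d) (b : 'cV[R]_d -> R -> 'cV[R]_d)
  (c : 'cV[R]_d -> R -> R).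
Local Notation leb := (@lebesgue_cV R d).
Implicit Types phi psi : fgrad R d.

Definition form_a0 (t : R) phi psi : R :=
  \int[leb]_(x in Om) dotv (A x t *m phi.2 x) (psi.2 x).

Definition form_a1 (t : R) phi psi : R :=
  \int[leb]_(x in Om) ((dotv (b x t) (phi.2 x) + c x t * phi.1 x) * psi.1 x).

Definition form_a (t : R) phi psi : R := form_a0 t phi psi + form_a1 t phi psi.

(* Here J = ]0, T]; A is also given at t = 0, by continuous extension. *)
Record coefficients (T : R) : Prop := Coefficients {
  coef_measA : forall i j t, 0 <= t <= T ->
    measurable_fun Om (fun x => A x t i j);
  coef_measb : forall i t, 0 < t <= T -> measurable_fun Om (fun x => b x t i 0);
  coef_measc : forall t, 0 < t <= T -> measurable_fun Om (fun x => c x t);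
  coef_sym : {ae leb, forall x, Om x -> forall t, 0 < t <= T ->
    (A x t)^T = A x t};
  coef_posdef : exists2 kappa : R, 0 < kappa &
    {ae leb, forall x, Om x -> forall t, 0 < t <= T ->
      forall xi : 'cV[R]_d, kappa * dotv xi xi <= dotv (A x t *m xi) xi};
  coef_bounded : exists M : R,
    {ae leb, forall x, Om x -> forall t, 0 < t <= T ->
      [/\ forall i j, `|A x t i j| <= M,
          forall i, `|b x t i 0| <= M &
          `|c x t| <= M]};
  coef_dtA : exists M : R,
    {ae leb, forall x, Om x -> forall i j,
      forall t, 0 < t < T ->
        derivable (fun s => A x s i j : R^o) t 1 /\
        `|derive1 (fun s => A x s i j : R^o) t| <= M};
  coef_contA : {ae leb, forall x, Om x -> forall i j,
    {within `[0, T], continuous (fun s => A x s i j : R^o)}}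
}.

End BilinearForms.

Section SpecialFunctions.
Context {R : realType}.

(* Euler's Gamma function, for x > 0 *)
Definition Gamma (x : R) : R :=
  \int[lebesgue_measure]_(s in `]0, +oo[) (s `^ (x - 1) * expR (- s)).

Definition mittag_leffler (alpha z : R) : R :=
  limn (series (fun j : nat => z ^+ j / Gamma (j%:R * alpha + 1))).

Definition kker (beta t : R) : R := t `^ (beta - 1) / Gamma beta.

End SpecialFunctions.

Inductive scheme := FullyImplicit | IMEX.

Section Discretization.
Context {R : realType}.

Definition mesh (T gamma : R) (N n : nat) : R := (n%:R / N%:R) `^ gamma * T.

Variable t : nat -> R.

Definition step_size (n : nat) : R := t n - t n.-1.

Definition step_ratio (n : nat) : R := step_size n / step_size n.-1.

Definition max_step (N : nat) : R :=
  \big[Num.max/0]_(1 <= n < N.+1) step_size n.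

Definition max_ratio (N : nat) : R :=
  \big[Num.max/0]_(2 <= n < N.+1) step_ratio n.

Definition L1_coef (alpha : R) (n j : nat) : R :=
  (step_size j)^-1 *
  \int[lebesgue_measure]_(s in `[t j.-1, t j]) kker (1 - alpha) (t n - s).

Definition L1_caputo {V : lmodType R} (alpha : R) (phi : nat -> V) (n : nat) : V :=
  \sum_(1 <= j < n.+1) L1_coef alpha n j *: (phi j - phi j.-1).

Definition extrapolation {V : lmodType R} (s : scheme) (phi : nat -> V)
    (n : nat) : V :=
  match s with
  | FullyImplicit => phi n
  | IMEX => if (n <= 1)%N then phi 0
            else (1 + step_ratio n) *: phi n.-1 - step_ratio n *: phi n.-2
  end.

End Discretization.

Section Constants.
Context {R : realType}.

Definition Lambda1 (s : scheme) (alpha T lambda beta0 beta1 beta2 L mu : R) : R :=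
  match s with
  | FullyImplicit => 2 * ((beta1 ^+ 2 + lambda ^+ 2 * beta2 ^+ 2) / beta0)
  | IMEX => 2 * ((beta1 ^+ 2 +
      2 * lambda ^+ 2 * beta2 ^+ 2 * ((1 + mu) ^+ 2 + mu ^+ 2)) / beta0)
  end + L * T `^ (1 - alpha) / (beta0 * Gamma (2 - alpha)).

Definition C1 (alpha T gamma0 beta0 : R) : R :=
  Num.max (Num.sqrt (gamma0 / beta0)) (Num.sqrt (2 * T `^ alpha / beta0)).

End Constants.

(* Main.v *)
Require Import Defs.
From HB Require Import structures.
From mathcomp Require Import all_boot all_order all_algebra.
From mathcomp Require Import all_classical all_reals all_analysis.
From mathcomp Require Import measurable_realfun.
From mathcomp Require Import ring lra.

Set Implicit Arguments.
Unset Strict Implicit.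
Unset Printing Implicit Defensive.
Import Order.TTheory GRing.Theory Num.Theory.
Import numFieldNormedType.Exports.

Local Open Scope classical_set_scope.
Local Open Scope ring_scope.

(** The a priori bound is an energy estimate closed by a discrete fractional
    Gronwall inequality.

    Energy.  Testing the scheme with the discrete Caputo derivative D of the
    solution turns the first term into the squared L2 norm of D, and Young's
    inequality absorbs into it every other term in which D appears.  What is
    left is a0(t_n; u^n, D).  The L1 weights K(n, j) increase with j, so by
    summation by parts D is, up to positive weights, a combination of the
    differences u^n - u^j; since 2 a0(u, v) <= a0(u, u) + a0(v, v), the form
    a0(t_n; u^n, D) dominates half of the discrete derivative of
    j |-> a0(t_n; u^j, u^j) ([form_a0_caputo_ge]).  Replacing the time t_n by
    t_j inside the form costs L (t_n - t_j) for each j, and these errors add up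
    to the discrete derivative of the function t, which is
    t_n^(1-alpha) / Gamma(2-alpha) ([energy_frozen_time]).  Hence the energies
    q_j = a0(t_j; u^j, u^j) satisfy
      D q_n <= Lambda max_(j <= n) q_j + max_(j <= n) |f^j|^2.

    Gronwall ([L1_gronwall]).  The running maximum M of q satisfies the same
    inequality ([L1_running_max]).  As M is nondecreasing and the step
    restriction says 2 Lambda <= K(n, n), the newest value of M can be absorbed,
    leaving the explicit recursion D M_n <= 2 Lambda M_(n-1) + 2 F.  By the
    discrete maximum principle ([L1_comparison]), and after the constant F has
    been shifted away with a multiple of t^alpha / Gamma(1+alpha), whose discrete
    derivative is at least 1, M lies below every W with a larger initial value
    and D W_n >= 2 Lambda W_(n-1).  The Mittag-Leffler function
    W = E_alpha(2 Lambda t^alpha) is such a supersolution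
    ([L1_mittag_leffler]).  This is checked on each term
    t^p / Gamma(p+1), p = m alpha, of its series: the discrete derivative at t_n
    must dominate the exact Caputo derivative at t_(n-1).  If p <= 1 the power
    is concave, and Chebyshev's integral inequality on every mesh interval even
    shows that it dominates the one at t_n ([L1_kker_concave]); if p >= 1 it is
    convex, and the memory integral is translated by the last step, which is the
    longest one on a graded mesh ([L1_kker_convex]).

    The exact Caputo derivative of a power is Euler's Beta integral; its value
    in terms of Gamma comes from integrating exp(-t) times the convolution of
    two powers in both orders ([gamma_integralM]). *)

(** * Affine changes of variables *)

Section affine_change_of_variables.
Context {R : realType}.
Local Notation leb := (@lebesgue_measure R).
Local Open Scope ereal_scope.

Lemma affine_preimage_itv (c b x y : R) : (0 < c)%R ->
  (fun z => c * z + b)%R @^-1` `]x, y] = `]((x - b) / c)%R, ((y - b) / c)%R]%classic.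
Proof.
move=> c0; apply/seteqP; split=> z /=; rewrite !in_itv/=.
  by rewrite ltr_pdivrMr// ler_pdivlMr// ltrBlDr lerBrDr ![(z * c)%R]mulrC.
by rewrite ltr_pdivrMr// ler_pdivlMr// ltrBlDr lerBrDr ![(z * c)%R]mulrC.
Qed.

Lemma measurable_affine (c b : R) (D : set R) :
  measurable_fun D (fun x : R => c * x + b)%R.
Proof. by apply: measurable_funD => //; exact: measurable_funM. Qed.

Let affine (c b : R) : measurableTypeR R -> measurableTypeR R :=
  fun x => (c * x + b)%R.

Let maffine c b : measurable_fun setT (affine c b).
Proof. exact: measurable_affine. Qed.

Let image (c b : R) : {measure set measurableTypeR R -> \bar R} :=
  measure_function_pushforward__canonical__measure_function_Measure
    leb (maffine c b).

(** A measure on the line is determined by its values on intervals, where the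
    scaling factor is visible. *)
Lemma lebesgue_measure_affine (c b : R) (c0 : (0 < c)%R) (A : set R) :
  measurable A -> mscale (NngNum (ltW c0)) (image c b) A = leb A.
Proof.
move=> mA; apply/esym; apply: lebesgue_measure_unique => //= _ [[x y]] _ <-.
rewrite /mscale/= /pushforward affine_preimage_itv// !lebesgue_measure_itv/=.
rewrite !lte_fin ltr_pM2r ?invr_gt0// ltrBlDr subrK.
case: ifPn => _; last by rewrite mule0.
by rewrite -EFinB -EFinM -mulrBl opprB addrA subrK mulrC divfK ?gt_eqF.
Qed.

Lemma ge0_integral_affine (c b : R) (D : set R) (f : R -> \bar R) :
  (0 < c)%R -> measurable D -> measurable_fun D f ->
  (forall x, D x -> 0 <= f x) ->
  \int[leb]_(x in D) f x =
  c%:E * \int[leb]_(x in (fun z => c * z + b)%R @^-1` D) f (c * x + b)%R.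
Proof.
move=> c0 mD mf f0.
rewrite -(ge0_integral_pushforward (maffine c b))//; last first.
  by move=> y /set_mem; exact: f0.
rewrite -(@ge0_integral_mscale _ _ _ (image c b) _ mD (NngNum (ltW c0)) f)//.
apply: eq_measure_integral => A mA _.
exact/esym/lebesgue_measure_affine.
Qed.

Lemma ge0_integral_reflect (b : R) (D : set R) (f : R -> \bar R) :
  measurable D -> measurable_fun D f ->
  (forall x, D x -> 0 <= f x) ->
  \int[leb]_(x in D) f x =
  \int[leb]_(x in (fun z => b - z)%R @^-1` D) f (b - x)%R.
Proof.
move=> mD mf f0.
have mN : measurable_fun setT (-%R : measurableTypeR R -> measurableTypeR R).
  exact: oppr_measurable.
transitivity (\int[leb]_(x in (-%R : measurableTypeR R -> measurableTypeR R) @^-1` D) f (- x)%R).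
  rewrite -(@ge0_integral_pushforward _ _ _ _ _ _ mN leb D f)//; last first.
    by move=> y /set_mem; exact: f0.
  apply: eq_measure_integral => A mA _.
  exact/esym/lebesgue_measureN.
rewrite (@ge0_integral_affine 1 (- b) _ (fun x => f (- x)%R)) => //.
- rewrite mul1e [X in integral _ X _](_ : _ = (fun z => b - z)%R @^-1` D).
    by apply: eq_integral => x _; rewrite mul1r opprD opprK addrC.
  apply/seteqP; split => x /=.
    by rewrite mul1r opprD opprK addrC.
  by rewrite mul1r opprD opprK [(b - x)%R]addrC.
- by rewrite -[X in measurable X]setTI; exact: mN.
- have := @measurable_comp _ _ _ _ _ _ D f (-%R @^-1` D) (-%R) mD.
  apply=> //; first by move=> _ [x/= Dx <-].
- by move=> x; exact: f0.
Qed.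

End affine_change_of_variables.

(** * Euler's Beta and Gamma integrals *)

Section power_integrals.
Context {R : realType}.
Local Notation leb := (@lebesgue_measure R).

Lemma measurable_powR_comp d (S : measurableType d) (D : set S) (f : S -> R)
    (p : R) :
  measurable_fun D f -> measurable_fun D (fun x => f x `^ p).
Proof. by move=> mf; apply: (measurableT_comp (measurable_powR p)). Qed.

Lemma continuous_powR_gt0 (p x : R) : 0 < x -> {for x, continuous (@powR R ^~ p)}.
Proof.
move=> x0; apply/differentiable_continuous/derivable1_diffP.
by apply: derivable_powR; rewrite in_itv/= x0.
Qed.

Lemma integral_powR_gt0 (p a b : R) : p != 0 -> 0 < a -> a <= b ->
  (\int[leb]_(s in `[a, b]) (s `^ (p - 1))%:E =
   ((b `^ p - a `^ p) / p)%:E)%E.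
Proof.
move=> p0 a0; rewrite le_eqVlt => /predU1P[<-|ab].
  by rewrite set_itv1 integral_set1 subrr mul0r.
rewrite (@continuous_FTC2 _ _ (fun x => p^-1 * x `^ p)) //.
- by rewrite -EFinB -mulrBr mulrC.
- apply: continuous_in_subspaceT => x /set_mem/=; rewrite in_itv/= => /andP[ax _].
  by apply: continuous_powR_gt0; exact: lt_le_trans ax.
- have c x : a <= x -> {for x, continuous (fun x => p^-1 * x `^ p)}.
    move=> ax; apply: continuousM; first exact: cst_continuous.
    by apply: continuous_powR_gt0; exact: lt_le_trans ax.
  split.
  + move=> x; rewrite in_itv/= => /andP[ax _].
    apply: derivableM => //; apply: derivable_powR.
    by rewrite in_itv/= (lt_trans a0).
  + by apply/cvg_at_right_filter; exact: c.
  + by apply/cvg_at_left_filter; apply: c; exact: ltW.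
- move=> x; rewrite in_itv/= => /andP[ax _].
  have x0 := lt_trans a0 ax.
  rewrite derive1E deriveM//; last first.
    by apply: derivable_powR; rewrite in_itv/= x0.
  rewrite derive_cst scaler0 addr0 -derive1E powR_derive1 ?in_itv/= ?x0//.
  by rewrite /GRing.scale/= mulrA mulVf// mul1r.
Qed.

(** For p < 1 the integrand is unbounded at 0, so the value is the limit of the
    integrals over intervals that exclude a neighbourhood of 0. *)
Lemma integral_powR0 (p b : R) : 0 < p -> 0 <= b ->
  (\int[leb]_(s in `]0%R, b]) (s `^ (p - 1))%:E = (b `^ p / p)%:E)%E.
Proof.
move=> p0; rewrite le_eqVlt => /predU1P[<-|b0].
  rewrite set_itv_ge ?integral_set0 -?leNgt ?bnd_simp//.
  by rewrite powR0 ?mul0r// gt_eqF.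
(* intervals that exhaust ]0, b] from inside, away from the singularity *)
pose F (n : nat) := `[n.+1%:R^-1 * b, b]%classic.
have UF : \bigcup_n F n = `]0, b]%classic.
  apply/seteqP; split => [x [n _]|x]; rewrite /F/= !in_itv/= => /andP[h xb].
    by rewrite xb andbT (lt_le_trans _ h)// mulr_gt0.
  exists (Num.truncn (b / x)) => //=; rewrite in_itv/= xb andbT.
  by rewrite mulrC ler_pdivrMr// mulrC -ler_pdivrMr// ltW// truncnS_gt.
rewrite -UF.
have := @ge0_nondecreasing_set_cvg_integral _ (measurableTypeR R) R F
  (fun s => (s `^ (p - 1))%:E) leb.
move=> /(_ _ _ _ _)/cvg_lim <-//; last first.
- by move=> i x _; rewrite lee_fin powR_ge0.
- by move=> i; apply/measurable_EFinP; apply: measurable_powR_comp; exact: measurable_id.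
- by move=> i; exact: measurable_itv.
- move=> m n mn; rewrite subsetEset /F; apply: subset_itvr.
  by rewrite bnd_simp ler_pM2r// lef_pV2 ?posrE// ler_nat ltnS.
apply: cvg_lim => //.
rewrite (_ : (fun _ => _) =
  (fun n => (b `^ p / p - (n.+1%:R^-1) `^ p * (b `^ p / p))%:E)); last first.
  apply/funext => n; rewrite integral_powR_gt0 ?gt_eqF ?mulr_gt0//.
    by rewrite mulrBl powRM ?ltW ?mulrA// mulr_gt0.
  by rewrite -[leRHS]mul1r ler_pM2r// invf_le1// ler1n.
apply: cvg_EFin; first by near=> n.
rewrite -[X in _ --> X]subr0 -[X in _ - X](mul0r (b `^ p / p)).
apply: cvgB; first exact: cvg_cst.
apply: cvgM; last exact: cvg_cst.
have /cvg_at_rightP := powR_cvg0 p0; apply; split=> [n|].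
  by rewrite invr_gt0.
exact: cvg_harmonic.
Unshelve. all: by end_near. Qed.

End power_integrals.

Section beta_gamma.
Context {R : realType}.
Local Notation leb := (@lebesgue_measure R).

Lemma integral_powR (p a b : R) : 0 < p -> 0 <= a -> a <= b ->
  (\int[leb]_(s in `]a, b[) (s `^ (p - 1))%:E = ((b `^ p - a `^ p) / p)%:E)%E.
Proof.
move=> p0; have mp (D : set R) : measurable_fun D (fun s => (s `^ (p - 1))%:E).
  apply/measurable_EFinP; apply: measurable_powR_comp; exact: measurable_id.
rewrite le_eqVlt => /predU1P[<-|a0] ab.
  rewrite -(@integral_itv_bndoo _ _ _ _ false false) ?integral_powR0//.
  by rewrite powR0 ?subr0// gt_eqF.
by rewrite -(@integral_itv_bndoo _ _ _ _ true false) ?integral_powR_gt0 ?gt_eqF.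
Qed.

Lemma integral_powR_reflect (p a b t : R) : 0 < p -> a <= b -> b <= t ->
  (\int[leb]_(s in `]a, b[) ((t - s) `^ (p - 1))%:E =
   (((t - a) `^ p - (t - b) `^ p) / p)%:E)%E.
Proof.
move=> p0 ab bt; rewrite (ge0_integral_reflect t)//; last first.
- by move=> x _; rewrite lee_fin powR_ge0.
- apply/measurable_EFinP; apply: measurable_powR_comp; exact: measurable_funB.
rewrite (_ : _ @^-1` _ = `]t - b, t - a[%classic); last first.
  apply/seteqP; split=> x /=; rewrite !in_itv/=.
    by move=> /andP[ax xb]; apply/andP; split; lra.
  by move=> /andP[ax xb]; apply/andP; split; lra.
under eq_integral do rewrite subKr.
by rewrite integral_powR// ?subr_ge0// lerB.
Qed.

(** Gamma and Beta are first treated as extended reals: their product formula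
    holds before finiteness is known, and finiteness is deduced from it. *)
Definition gamma_integral (p : R) : \bar R :=
  (\int[leb]_(s in `]0%R, +oo[) (s `^ (p - 1) * expR (- s))%:E)%E.

(** The convolution of two powers at the point t; t = 1 gives Euler's Beta
    integral. *)
Definition beta_integral (a b t : R) : \bar R :=
  (\int[leb]_(s in `]0%R, t[) ((t - s) `^ (a - 1) * s `^ (b - 1))%:E)%E.

Lemma measurable_gamma_integrand (p : R) (D : set R) :
  measurable_fun D (fun s : R => (s `^ (p - 1) * expR (- s))%:E).
Proof.
apply/measurable_EFinP; apply: measurable_funM.
  by apply: measurable_powR_comp; exact: measurable_id.
apply: (measurableT_comp (@measurable_expR R)); exact: oppr_measurable.
Qed.

Lemma measurable_beta_integrand (a b t : R) (D : set R) :
  measurable_fun D (fun s : R => ((t - s) `^ (a - 1) * s `^ (b - 1))%:E).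
Proof.
apply/measurable_EFinP; apply: measurable_funM; apply: measurable_powR_comp.
  exact: measurable_funB.
exact: measurable_id.
Qed.

Lemma beta_integral_scale (a b t : R) : 0 < t ->
  (beta_integral a b t = (t `^ (a + b - 1))%:E * beta_integral a b 1)%E.
Proof.
move=> t0; rewrite /beta_integral (@ge0_integral_affine _ t 0); first last.
- by move=> x _; rewrite lee_fin mulr_ge0 ?powR_ge0.
- exact: measurable_beta_integrand.
- exact: measurable_itv.
- exact: t0.
rewrite (_ : _ @^-1` _ = `]0, 1[%classic); last first.
  apply/seteqP; split=> x /=; rewrite !in_itv/= addr0.
    by rewrite pmulr_rgt0// => /andP[->]/=; rewrite -ltr_pdivlMl// mulVf ?gt_eqF.
  by move=> /andP[x0 x1]; rewrite mulr_gt0//= -ltr_pdivlMl// mulVf ?gt_eqF.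
rewrite -!ge0_integralZl; first last.
- by rewrite lee_fin (ltW t0).
- by move=> x _; rewrite lee_fin mulr_ge0 ?powR_ge0.
- apply/measurable_EFinP; apply: measurable_funM; apply: measurable_powR_comp.
    by apply: measurable_funB => //; exact: measurable_affine.
  exact: measurable_affine.
- exact: measurable_itv.
- by rewrite lee_fin powR_ge0.
- by move=> x _; rewrite lee_fin mulr_ge0 ?powR_ge0.
- exact: measurable_beta_integrand.
- exact: measurable_itv.
apply: eq_integral => x; rewrite inE/= in_itv/= => /andP[x0 x1].
rewrite -!EFinM addr0 -{2}(mulr1 t) -mulrBr !powRM ?(ltW t0) ?(ltW x0)//; last first.
  by rewrite subr_ge0 ltW.
congr EFin.
have -> : t `^ (a + b - 1) = t * t `^ (a - 1) * t `^ (b - 1).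
  rewrite -{2}[t]powRr1 ?ltW// -!powRD ?(gt_eqF t0) ?implybT//.
  by congr (_ `^ _); lra.
by ring.
Qed.

Lemma gamma_integral_shift (p s : R) :
  (\int[leb]_(t in `]s, +oo[) ((t - s) `^ (p - 1) * expR (- t))%:E =
   (expR (- s))%:E * gamma_integral p)%E.
Proof.
rewrite (@ge0_integral_affine _ 1 s)//; last first.
- by move=> x _; rewrite lee_fin mulr_ge0 ?powR_ge0 ?expR_ge0.
- apply/measurable_EFinP; apply: measurable_funM.
    by apply: measurable_powR_comp; apply: measurable_funB.
  apply: (measurableT_comp (@measurable_expR R)); exact: oppr_measurable.
rewrite mul1e (_ : _ @^-1` _ = `]0, +oo[%classic); last first.
  by apply/seteqP; split=> x /=; rewrite !in_itv/= !andbT mul1r ltrDr.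
rewrite -ge0_integralZl//=; first last.
- by move=> x _; rewrite lee_fin mulr_ge0 ?powR_ge0 ?expR_ge0.
- exact: measurable_gamma_integrand.
apply: eq_integral => x _.
by rewrite mul1r addrK opprD expRD -EFinM; congr EFin; ring.
Qed.

Lemma gamma_integral_ge0 p : (0 <= gamma_integral p)%E.
Proof.
by apply: integral_ge0 => x _; rewrite lee_fin mulr_ge0 ?powR_ge0 ?expR_ge0.
Qed.

Lemma beta_integral_ge0 a b t : (0 <= beta_integral a b t)%E.
Proof. by apply: integral_ge0 => x _; rewrite lee_fin mulr_ge0 ?powR_ge0. Qed.

(** Integrate exp(-t) against the convolution of the powers with exponents a - 1
    and b - 1.  By homogeneity the convolution at t is t^(a+b-1) times its value
    at 1, which gives the right-hand side; integrating over t first, the shift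
    t = s + r separates the variables and gives the left-hand side. *)
Lemma gamma_integralM (a b : R) :
  (gamma_integral a * gamma_integral b =
   beta_integral a b 1 * gamma_integral (a + b))%E.
Proof.
pose W : set (R * R) := [set z | 0 < z.2 /\ z.2 < z.1].
pose g (z : R * R) : R :=
  ((z.1 - z.2) `^ (a - 1) * z.2 `^ (b - 1)) * expR (- z.1).
pose F (z : R * R) : \bar R := ((EFin \o g) \_ W) z.
have mfst D : measurable_fun D (fst : measurableTypeR R * measurableTypeR R -> measurableTypeR R).
  exact: measurable_funS measurable_fst.
have msnd D : measurable_fun D (snd : measurableTypeR R * measurableTypeR R -> measurableTypeR R).
  exact: measurable_funS measurable_snd.
have mW : measurable (W : set (measurableTypeR R * measurableTypeR R)).
  have -> : W = (fun z : R * R => 0 < z.2) @^-1` [set true]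
     `&` (fun z : R * R => z.2 < z.1) @^-1` [set true] by [].
  by apply: measurableI; rewrite -[X in measurable X]setTI;
    apply: measurable_fun_ltr.
have mg (D : set (measurableTypeR R * measurableTypeR R)) : measurable_fun D g.
  apply: measurable_funM; first apply: measurable_funM.
  - by apply: measurable_powR_comp; apply: measurable_funB; [exact: mfst|exact: msnd].
  - by apply: measurable_powR_comp; exact: msnd.
  - apply: (measurableT_comp (@measurable_expR R)); apply: measurable_funN.
    exact: mfst.
have mF : measurable_fun [set: measurableTypeR R * measurableTypeR R] F.
  by apply/(measurable_restrictT _ mW)/measurable_EFinP; exact: mg.
have g0 z : 0 <= g z by rewrite /g !mulr_ge0 ?powR_ge0 ?expR_ge0.
have F0 z : (0 <= F z)%E.
  by rewrite /F; apply: erestrict_ge0 => x _; rewrite lee_fin.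
have inner_s t : (\int[leb]_s F (t, s) = ((fun t =>
    (t `^ (a + b - 1) * expR (- t))%:E * beta_integral a b 1) \_ `]0%R, +oo[) t)%E.
  rewrite patchE; have [t0|t0] := ltP 0 t; last first.
    rewrite memNset/= ?in_itv/= ?andbT ?ltNge ?t0// integral0_eq// => s _.
    rewrite /F patchE memNset// /W/= => -[/lt_trans/[apply]].
    by rewrite ltNge t0.
  rewrite mem_set/= ?in_itv/= ?t0//.
  transitivity (\int[leb]_(s in `]0%R, t[) (g (t, s))%:E)%E.
    rewrite [RHS]integral_mkcond; apply: eq_integral => s _.
    by rewrite /F !patchE; congr (if _ then _ else _); apply/idP/idP;
      rewrite !inE /W/= in_itv/= => /andP.
  rewrite EFinM [(_ * (expR _)%:E)%E]muleC -muleA -beta_integral_scale//.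
  rewrite -ge0_integralZl//=; last first.
  - by move=> s _; rewrite lee_fin mulr_ge0 ?powR_ge0.
  - exact: measurable_beta_integrand.
  by apply: eq_integral => s _; rewrite -EFinM mulrC.
have inner_t s : (\int[leb]_t F (t, s) = ((fun s =>
    (s `^ (b - 1) * expR (- s))%:E * gamma_integral a) \_ `]0%R, +oo[) s)%E.
  rewrite patchE; have [s0|s0] := ltP 0 s; last first.
    rewrite memNset/= ?in_itv/= ?andbT ?ltNge ?s0// integral0_eq// => t _.
    by rewrite /F patchE memNset// /W/= ltNge s0 => -[].
  rewrite mem_set/= ?in_itv/= ?s0//.
  transitivity (\int[leb]_(t in `]s, +oo[) (g (t, s))%:E)%E.
    rewrite [RHS]integral_mkcond; apply: eq_integral => t _.
    rewrite /F !patchE; congr (if _ then _ else _); apply/idP/idP;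
      rewrite !inE /W/= in_itv/= andbT; first by case.
    by move=> st; split.
  rewrite EFinM -muleA -gamma_integral_shift.
  rewrite -ge0_integralZl//=; last first.
  - by rewrite lee_fin powR_ge0.
  - by move=> t _; rewrite lee_fin mulr_ge0 ?powR_ge0 ?expR_ge0.
  - apply/measurable_EFinP; apply: measurable_funM.
      by apply: measurable_powR_comp; apply: measurable_funB.
    apply: (measurableT_comp (@measurable_expR R)); exact: oppr_measurable.
  by apply: eq_integral => t _; rewrite -EFinM /g/=; congr EFin; ring.
have := @fubini_tonelli _ _ _ _ R leb leb F mF F0.
under eq_integral => t _ do rewrite /fubini_F inner_s.
under [X in _ = X -> _]eq_integral => s _ do rewrite /fubini_G inner_t.
rewrite -!integral_mkcond !ge0_integralZr; first last.
- exact: beta_integral_ge0.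
- by move=> x _; rewrite lee_fin mulr_ge0 ?powR_ge0 ?expR_ge0.
- exact: measurable_gamma_integrand.
- exact: measurable_itv.
- exact: gamma_integral_ge0.
- by move=> x _; rewrite lee_fin mulr_ge0 ?powR_ge0 ?expR_ge0.
- exact: measurable_gamma_integrand.
- exact: measurable_itv.
rewrite -/(gamma_integral (a + b)) -/(gamma_integral b) => E.
by rewrite [RHS]muleC E muleC.
Qed.

End beta_gamma.

Section gamma_function.
Context {R : realType}.
Local Notation leb := (@lebesgue_measure R).
Local Notation Gamma := (@Gamma R).

Lemma gamma_integral1 : gamma_integral (1 : R) = 1%E.
Proof.
rewrite -(integral_exponential_pdf (@ltr01 R)) /gamma_integral.
rewrite integral_itv_obnd_cbnd; last exact: measurable_gamma_integrand.
rewrite integral_mkcond; apply: eq_integral => x _.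
rewrite /exponential_pdf !patchE; case: ifPn => //; rewrite inE/= in_itv/= andbT => x0.
by rewrite subrr powRr0 !mul1r mulN1r.
Qed.

(** The case a = 1 of the product formula, since Beta(1, b) = 1 / b. *)
Lemma gamma_integral_rec (b : R) : 0 < b ->
  gamma_integral b = (b^-1%:E * gamma_integral (b + 1))%E.
Proof.
move=> b0; have := gamma_integralM 1 b.
rewrite gamma_integral1 mul1e [(1 + b)%R]addrC => ->; congr (_ * _)%E.
rewrite /beta_integral.
under eq_integral do rewrite subrr powRr0 mul1r.
by rewrite integral_powR// powR1 powR0 ?gt_eqF// subr0 mul1r.
Qed.

Lemma gamma_integral_ltyS (b : R) : 0 < b ->
  (gamma_integral b < +oo)%E = (gamma_integral (b + 1) < +oo)%E.
Proof.
move=> b0; apply/idP/idP => h.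
  have -> : gamma_integral (b + 1) = (b%:E * gamma_integral b)%E.
    by rewrite [in RHS]gamma_integral_rec// muleA -EFinM divff ?gt_eqF ?mul1e.
  by rewrite lte_mul_pinfty// lee_fin ltW.
by rewrite gamma_integral_rec// lte_mul_pinfty// lee_fin invr_ge0 ltW.
Qed.

(** Finiteness spreads from the value at 1 along the recursion to all positive
    integers; between integers s^(x-1) <= 1 + s^n, and the recursion carries
    0 < x < 1 to x + 1 > 1. *)
Lemma gamma_integral_lty (p : R) : 0 < p -> (gamma_integral p < +oo)%E.
Proof.
have gnat (n : nat) : (gamma_integral (n.+1%:R : R) < +oo)%E.
  elim: n => [|n IH]; first by rewrite gamma_integral1 ltry.
  by rewrite -[n.+2]addn1 natrD -gamma_integral_ltyS.
have gge1 x : 1 <= x -> (gamma_integral (x : R) < +oo)%E.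
  move=> x1; set n := Num.truncn x.
  apply: (@le_lt_trans _ _ (gamma_integral 1 + gamma_integral (n.+1%:R : R))%E).
    rewrite /gamma_integral -ge0_integralD//; first last.
    - exact: measurable_gamma_integrand.
    - by move=> s _; rewrite lee_fin mulr_ge0 ?powR_ge0 ?expR_ge0.
    - exact: measurable_gamma_integrand.
    - by move=> s _; rewrite lee_fin mulr_ge0 ?powR_ge0 ?expR_ge0.
    apply: ge0_le_integral => //.
    - by move=> s _; rewrite lee_fin mulr_ge0 ?powR_ge0 ?expR_ge0.
    - exact: measurable_gamma_integrand.
    - by apply: emeasurable_funD; exact: measurable_gamma_integrand.
    - move=> s /=; rewrite in_itv/= andbT => s0.
      rewrite -EFinD lee_fin -mulrDl ler_pM2r ?expR_gt0// subrr powRr0.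
      have [s1|s1] := leP 1 s.
        apply: ler_wpDl => //; apply: ler_powR => //.
        by rewrite lerB// ltW// truncnS_gt.
      apply: ler_wpDr; first exact: powR_ge0.
      rewrite -[leRHS](powRr0 s); apply: ger_powR; first by rewrite s0 ltW.
      by rewrite subr_ge0.
  by rewrite gamma_integral1 lte_add_pinfty// ltry.
move=> p0; rewrite gamma_integral_ltyS//; apply: gge1.
by rewrite lerDr ltW.
Qed.

Lemma GammaE (p : R) : 0 < p -> gamma_integral p = (Gamma p)%:E.
Proof.
move=> p0; rewrite /Defs.Gamma /Rintegral fineK//.
by rewrite ge0_fin_numE ?gamma_integral_ge0// gamma_integral_lty.
Qed.

Lemma Gamma1 : Gamma 1 = 1.
Proof. by apply: EFin_inj; rewrite -GammaE// gamma_integral1. Qed.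

Lemma GammaS (p : R) : 0 < p -> Gamma (p + 1) = p * Gamma p.
Proof.
move=> p0; apply: EFin_inj; rewrite EFinM -!GammaE ?addr_gt0//.
by rewrite [in RHS]gamma_integral_rec// muleA -EFinM divff ?gt_eqF ?mul1e.
Qed.

(** On ]c, +oo[ one has s^p >= c^p.  As c is free, Gamma(p + 1) outgrows every
    geometric sequence in p. *)
Lemma Gamma_lbound (c p : R) : 0 < c -> 0 <= p ->
  c `^ p * expR (- c) <= Gamma (p + 1).
Proof.
move=> c0 p0; rewrite -lee_fin -GammaE ?ltr_wpDl//.
have := gamma_integral_shift 1 c.
rewrite gamma_integral1 mule1 subrr => e.
rewrite EFinM -e -ge0_integralZl//; first last.
- by rewrite lee_fin powR_ge0.
- by move=> s _; rewrite lee_fin mulr_ge0 ?powR_ge0 ?expR_ge0.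
- apply/measurable_EFinP; apply: measurable_funM.
    by apply: measurable_powR_comp; apply: measurable_funB.
  apply: (measurableT_comp (@measurable_expR R)); exact: oppr_measurable.
apply: (@le_trans _ _ (\int[leb]_(s in `]c, +oo[) (s `^ (p + 1 - 1) * expR (- s))%:E)%E).
  apply: ge0_le_integral => //.
  - by move=> s _; rewrite -EFinM lee_fin !mulr_ge0 ?powR_ge0 ?expR_ge0.
  - apply/measurable_EFinP; apply: measurable_funM => //; apply: measurable_funM.
      by apply: measurable_powR_comp; apply: measurable_funB.
    apply: (measurableT_comp (@measurable_expR R)); exact: oppr_measurable.
  - exact: measurable_gamma_integrand.
  - move=> s /=; rewrite in_itv/= andbT => cs.
    rewrite -EFinM lee_fin powRr0 mul1r addrK ler_pM2r ?expR_gt0//.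
    by apply: ge0_ler_powR => //; rewrite ?nnegrE ?ltW// (lt_trans c0).
apply: ge0_subset_integral => //.
- exact: measurable_gamma_integrand.
- by move=> s _; rewrite lee_fin mulr_ge0 ?powR_ge0 ?expR_ge0.
- by move=> s /=; rewrite !in_itv/= !andbT; exact: lt_trans.
Qed.

Lemma Gamma_gt0 (p : R) : 0 < p -> 0 < Gamma p.
Proof.
move=> p0; rewrite -(pmulr_rgt0 _ p0) -GammaS//.
by apply: lt_le_trans (@Gamma_lbound 1 p _ _); rewrite ?mulr_gt0 ?powR_gt0 ?expR_gt0// ltW.
Qed.

(** The previous bound with c = 1 gives 1 / e, and e <= 4. *)
Lemma Gamma_ge_quarter (p : R) : 0 <= p -> 4^-1 <= Gamma (p + 1).
Proof.
move=> p0; apply: le_trans (Gamma_lbound ltr01 p0).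
rewrite powR1 mul1r expRN lef_pV2 ?posrE ?expR_gt0//.
have h : expR (1 / 2) <= 2 :> R.
  have := expR_ge1Dx (- (1 / 2) : R); rewrite expRN => h.
  by rewrite -[leRHS]invrK -lef_pV2 ?posrE ?invr_gt0 ?expR_gt0// invrK; lra.
have -> : (1 : R) = 1 / 2 + 1 / 2 by lra.
rewrite expRD; have e0 := expR_ge0 (1 / 2 : R); nra.
Qed.

Lemma beta_integralE (a b t : R) : 0 < a -> 0 < b -> 0 < t ->
  beta_integral a b t =
  (Gamma a * Gamma b / Gamma (a + b) * t `^ (a + b - 1))%:E.
Proof.
move=> a0 b0 t0; have := gamma_integralM a b.
rewrite !GammaE ?addr_gt0// => h.
have G0 := Gamma_gt0 (addr_gt0 a0 b0).
have -> : (Gamma a * Gamma b / Gamma (a + b) * t `^ (a + b - 1))%:E =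
   ((Gamma a * Gamma b)%:E * (t `^ (a + b - 1) / Gamma (a + b))%:E)%E.
  by rewrite -EFinM; congr EFin; ring.
rewrite EFinM h -muleA -EFinM mulrCA divff ?gt_eqF// mulr1.
by rewrite muleC -beta_integral_scale.
Qed.

Lemma kker_ge0 (b t : R) : 0 < b -> 0 <= kker b t.
Proof. by move=> b0; rewrite divr_ge0 ?powR_ge0// ltW// Gamma_gt0. Qed.

Lemma measurable_kker d (S : measurableType d) (D : set S) (f : S -> R) b :
  measurable_fun D f -> measurable_fun D (fun s => kker b (f s)).
Proof. by move=> mf; apply: measurable_funM => //; exact: measurable_powR_comp. Qed.

(** The semigroup property of fractional integration kernels; with a = 1 - alpha
    it computes the Caputo derivative of a power. *)
Lemma kker_convolution (a b t : R) : 0 < a -> 0 < b -> 0 < t ->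
  (\int[leb]_(s in `]0%R, t[) (kker a (t - s) * kker b s)%:E = (kker (a + b) t)%:E)%E.
Proof.
move=> a0 b0 t0.
have Ga := Gamma_gt0 a0; have Gb := Gamma_gt0 b0; have Gab := Gamma_gt0 (addr_gt0 a0 b0).
transitivity (((Gamma a * Gamma b)^-1)%:E * beta_integral a b t)%E.
  rewrite -ge0_integralZl//; first last.
  - by rewrite lee_fin invr_ge0 mulr_ge0 ?(ltW Ga) ?(ltW Gb).
  - by move=> x _; rewrite lee_fin mulr_ge0 ?powR_ge0.
  - exact: measurable_beta_integrand.
  apply: eq_integral => x _; rewrite -EFinM /kker invfM; congr EFin; ring.
rewrite beta_integralE// -EFinM /kker; congr EFin.
move: (Gamma a) (Gamma b) (Gamma _) (t `^ _) Ga Gb Gab => x y z w x0 y0 z0.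
by field; rewrite (gt_eqF x0) (gt_eqF y0) (gt_eqF z0).
Qed.

Lemma integral_kker (b x y : R) : 0 < b -> 0 <= x -> x <= y ->
  (\int[leb]_(s in `]x, y[) (kker b s)%:E = (kker (b + 1) y - kker (b + 1) x)%:E)%E.
Proof.
move=> b0 x0 xy; rewrite /kker.
under eq_integral do rewrite mulrC EFinM.
rewrite ge0_integralZl//; first last.
- by rewrite lee_fin invr_ge0 ltW// Gamma_gt0.
- by move=> s _; rewrite lee_fin powR_ge0.
- apply/measurable_EFinP; apply: measurable_powR_comp; exact: measurable_id.
rewrite integral_powR// -EFinM !addrK GammaS//; congr EFin.
by field; rewrite !gt_eqF ?Gamma_gt0.
Qed.

Lemma integral_kker_reflect (b x y t : R) : 0 < b -> x <= y -> y <= t ->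
  (\int[leb]_(s in `]x, y[) (kker b (t - s))%:E =
   (kker (b + 1) (t - x) - kker (b + 1) (t - y))%:E)%E.
Proof.
move=> b0 xy yt; rewrite /kker.
under eq_integral do rewrite mulrC EFinM.
rewrite ge0_integralZl//; first last.
- by rewrite lee_fin invr_ge0 ltW// Gamma_gt0.
- by move=> s _; rewrite lee_fin powR_ge0.
- apply/measurable_EFinP; apply: measurable_powR_comp; exact: measurable_funB.
rewrite integral_powR_reflect// -EFinM !addrK GammaS//; congr EFin.
by field; rewrite !gt_eqF ?Gamma_gt0.
Qed.

End gamma_function.

(** * Convergence of the Mittag-Leffler series *)

Section mittag_leffler.
Context {R : realType}.
Variables (alpha : R).
Hypothesis alpha0 : 0 < alpha.

(** The summand of [mittag_leffler], named so that its partial sums can be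
    manipulated. *)
Definition ml_term (z : R) (j : nat) : R := z ^+ j / Gamma (j%:R * alpha + 1).

Lemma ml_term_ge0 z j : 0 <= z -> 0 <= ml_term z j.
Proof.
move=> z0; rewrite divr_ge0 ?exprn_ge0// ltW// Gamma_gt0//.
by rewrite ltr_wpDl// mulr_ge0// ltW.
Qed.

(** With c^alpha = 2 (z + 1) the lower bound c^p exp(-c) <= Gamma(p + 1) compares
    the series with a geometric one of ratio 1/2. *)
Lemma is_cvg_ml (z : R) : 0 <= z -> cvgn (series (ml_term z)).
Proof.
move=> z0.
pose c := (2 * (z + 1)) `^ alpha^-1.
have c0 : 0 < c by rewrite powR_gt0// mulr_gt0// ltr_wpDl.
have ca : c `^ alpha = 2 * (z + 1).
  by rewrite -powRrM mulVf ?gt_eqF// powRr1// mulr_ge0// addr_ge0.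
apply: (@series_le_cvg _ (ml_term z) (geometric (expR c) 2^-1)).
- by move=> n; exact: ml_term_ge0.
- by move=> n; rewrite /geometric/= mulr_ge0 ?expR_ge0// exprn_ge0.
- move=> n; rewrite /geometric/= /ml_term.
  have na0 : 0 <= n%:R * alpha by rewrite mulr_ge0// ltW.
  have G0 : 0 < Gamma (n%:R * alpha + 1) by apply: Gamma_gt0; rewrite ltr_wpDl.
  rewrite ler_pdivrMr//.
  apply: (@le_trans _ _ (expR c * 2^-1 ^+ n * (c `^ (n%:R * alpha) * expR (- c)))).
    rewrite [n%:R * alpha]mulrC powRrM ca powR_mulrn ?mulr_ge0 ?addr_ge0//.
    have -> : expR c * 2^-1 ^+ n * ((2 * (z + 1)) ^+ n * expR (- c)) =
      (expR c * expR (- c)) * (2^-1 * (2 * (z + 1))) ^+ n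
      by rewrite [(2^-1 * _) ^+ n]exprMn; ring.
    rewrite expRxMexpNx_1 mul1r mulrA mulVf ?pnatr_eq0// mul1r.
    by rewrite lerXn2r ?nnegrE ?addr_ge0// lerDl.
  rewrite ler_wpM2l ?mulr_ge0 ?expR_ge0 ?exprn_ge0//; exact: Gamma_lbound.
- by apply: is_cvg_geometric_series; rewrite ger0_norm// invf_lt1// ltr1n.
Qed.

Lemma mittag_leffler_ge1 (z : R) : 0 <= z -> 1 <= mittag_leffler alpha z.
Proof.
move=> z0; apply: (@le_trans _ _ (series (ml_term z) 1%N)).
  by rewrite /series/= big_nat1 /ml_term expr0 mul0r add0r Gamma1 divr1.
apply: nondecreasing_cvgn_le; last exact: is_cvg_ml.
apply/nondecreasing_seqP => n; rewrite -subr_ge0 /series/= big_nat_recr//= addrAC subrr add0r.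
exact: ml_term_ge0.
Qed.

End mittag_leffler.

(** * Weighted sums of increments *)

Section weighted_increments.
Context {R : realType}.
Implicit Types (w x y : nat -> R) (n : nat).

(** With w = K(n, .) this is the L1 derivative at t_n of a scalar sequence; the
    weights are kept free because the comparison arguments only use their sign
    and monotonicity. *)
Definition winc w x n : R := \sum_(1 <= j < n.+1) w j * (x j - x j.-1).

Lemma wincS w x n : winc w x n.+1 = winc w x n + w n.+1 * (x n.+1 - x n).
Proof. by rewrite /winc big_nat_recr. Qed.

Lemma winc0 w x : winc w x 0 = 0.
Proof. by rewrite /winc big_geq. Qed.

Lemma eq_winc w x y n : (forall j, (j <= n)%N -> x j = y j) -> winc w x n = winc w y n.
Proof.
move=> xy; rewrite /winc; apply: eq_big_nat => j /andP[j1 jn].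
by rewrite !xy// (leq_trans (leq_pred _)).
Qed.

Lemma wincD w x y n : winc w (fun j => x j + y j) n = winc w x n + winc w y n.
Proof. by rewrite /winc -big_split/=; apply: eq_bigr => j _; ring. Qed.

Lemma wincZ w x c n : winc w (fun j => c * x j) n = c * winc w x n.
Proof. by rewrite /winc mulr_sumr; apply: eq_bigr => j _; ring. Qed.

Lemma winc_cst w c n : winc w (fun=> c) n = 0.
Proof. by rewrite /winc big1// => j _; rewrite subrr mulr0. Qed.

Lemma winc_by_parts w x n : winc w x n.+1 =
  w n.+1 * x n.+1 - \sum_(1 <= j < n.+1) (w j.+1 - w j) * x j - w 1%N * x 0%N.
Proof.
elim: n => [|n IH]; first by rewrite wincS winc0 big_geq//; ring.
by rewrite wincS IH [in RHS]big_nat_recr//=; ring.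
Qed.

(** After summation by parts every x_j with j < n carries a nonpositive
    coefficient, because the weights increase, and x_n a nonnegative one. *)
Lemma winc_max_principle w x n : (0 < n)%N -> 0 <= w 1%N ->
  (forall j, (0 < j < n)%N -> w j <= w j.+1) ->
  0 <= x n -> (forall j, (j < n)%N -> x j <= 0) -> 0 <= winc w x n.
Proof.
case: n => // n _ w1 wS xn xj; rewrite winc_by_parts.
have wn : 0 <= w n.+1.
  have : forall k, (k <= n)%N -> 0 <= w k.+1.
    elim=> // k IH kn; apply: le_trans (wS _ _); last by rewrite ltnS.
    by apply: IH; exact: ltnW.
  by apply.
rewrite subr_ge0; apply: (@le_trans _ _ 0).
  by rewrite mulr_ge0_le0// xj.
rewrite subr_ge0; apply: (@le_trans _ _ 0); last exact: mulr_ge0.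
rewrite big_nat; apply: sumr_le0 => j /andP[j1 jn].
by rewrite mulr_ge0_le0 ?subr_ge0 ?wS ?j1// xj// ltnS ltnW.
Qed.

Lemma winc_le w x y n : (0 < n)%N -> 0 <= w 1%N ->
  (forall j, (0 < j < n)%N -> w j <= w j.+1) ->
  x n <= y n -> (forall j, (j < n)%N -> y j <= x j) -> winc w x n <= winc w y n.
Proof.
move=> n0 w1 wS xyn xyj; rewrite -subr_ge0.
have -> : winc w y n - winc w x n = winc w (fun j => y j - x j) n.
  by rewrite -mulN1r -wincZ -wincD; apply: eq_winc => j _; rewrite mulN1r.
by apply: winc_max_principle => //; [rewrite subr_ge0|move=> j jn; rewrite subr_le0 xyj].
Qed.

Lemma winc_le_weight v w x n : (forall j, (0 < j <= n)%N -> v j <= w j) ->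
  (forall j, (0 < j <= n)%N -> x j.-1 <= x j) -> winc v x n <= winc w x n.
Proof.
move=> vw xS; rewrite /winc big_nat [leRHS]big_nat.
by apply: ler_sum => j jn; rewrite ler_wpM2r ?subr_ge0 ?xS ?vw.
Qed.

End weighted_increments.

(** * Chebyshev's integral inequality *)

Section chebyshev.
Context {R : realType}.
Local Notation leb := (@lebesgue_measure R).

Lemma integral_cst_itv (c x y : R) : x <= y ->
  (\int[leb]_(s in `]x, y[) c%:E = (c * (y - x))%:E)%E.
Proof.
move=> xy; transitivity (c%:E * leb `]x, y[)%E; first by rewrite integral_cst.
rewrite lebesgue_measure_itv/= lte_fin.
case: ltP => xy'; first by rewrite -EFinD -EFinM.
have -> : y = x by apply/le_anti; rewrite xy xy'.
by rewrite subrr mulr0 mule0.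
Qed.

(** The hypothesis reads f(s) g(s) + f(c) g(c) <= f(s) g(c) + f(c) g(s);
    integrating first over s and then over c gives twice the claim.  The
    integrated inequality at the midpoint also shows that the left-hand side
    is finite. *)
Lemma integral_chebyshev (f g : R -> R) (x y If Ig : R) : x < y ->
  (forall D : set R, measurable_fun D f) -> (forall D : set R, measurable_fun D g) ->
  (forall s, 0 <= f s) -> (forall s, 0 <= g s) ->
  (forall a b, a \in `]x, y[ -> b \in `]x, y[ -> (f a - f b) * (g a - g b) <= 0) ->
  (\int[leb]_(s in `]x, y[) (f s)%:E = If%:E)%E ->
  (\int[leb]_(s in `]x, y[) (g s)%:E = Ig%:E)%E ->
  (\int[leb]_(s in `]x, y[) (f s * g s)%:E <= (If * Ig / (y - x))%:E)%E.
Proof.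
move=> xy mf mg f0 g0 fg fE gE.
have mf' D : measurable_fun D (EFin \o f) by apply/measurable_EFinP.
have mg' D : measurable_fun D (EFin \o g) by apply/measurable_EFinP.
have mfg' D : measurable_fun D (fun s => (f s * g s)%:E).
  by apply/measurable_EFinP; exact: measurable_funM.
set X := (\int[leb]_(s in `]x, y[) (f s * g s)%:E)%E.
have intfg a b : 0 <= a -> 0 <= b ->
    (\int[leb]_(s in `]x, y[) (a * g s + b * f s)%:E = (a * Ig + b * If)%:E)%E.
  move=> a0 b0; under eq_integral do rewrite EFinD !EFinM.
  rewrite ge0_integralD//; first last.
  - by apply: emeasurable_funM => //; exact: mf'.
  - by move=> s _; rewrite -EFinM lee_fin mulr_ge0.
  - by apply: emeasurable_funM => //; exact: mg'.
  - by move=> s _; rewrite -EFinM lee_fin mulr_ge0.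
  rewrite !ge0_integralZl ?fE ?gE//.
  - exact: mf'.
  - by move=> s _; rewrite lee_fin.
  - exact: mg'.
  - by move=> s _; rewrite lee_fin.
have Xle c : c \in `]x, y[ -> (X + (f c * g c * (y - x))%:E <= (f c * Ig + g c * If)%:E)%E.
  move=> cxy; rewrite -(integral_cst_itv _ (ltW xy)) -ge0_integralD//; first last.
  - by move=> s _; rewrite lee_fin mulr_ge0.
  - exact: mfg'.
  - by move=> s _; rewrite lee_fin mulr_ge0.
  rewrite -intfg//; apply: ge0_le_integral => //.
  - by move=> s _; rewrite -EFinD lee_fin addr_ge0 ?mulr_ge0.
  - by apply: emeasurable_funD => //; exact: mfg'.
  - by apply/measurable_EFinP; apply: measurable_funD; apply: measurable_funM => //; [exact: mg|exact: mf].
  - by move=> s sxy; rewrite -EFinD lee_fin; have := fg _ _ cxy sxy; lra.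
have X0 : (0 <= X)%E by apply: integral_ge0 => s _; rewrite lee_fin mulr_ge0.
have Xfin : X \is a fin_num.
  rewrite ge0_fin_numE//; have mid : (x + y) / 2 \in `]x, y[.
    by rewrite in_itv/=; apply/andP; split; lra.
  apply: le_lt_trans (ltry (f ((x + y) / 2) * Ig + g ((x + y) / 2) * If)).
  apply: le_trans (Xle _ mid); rewrite leeDl// lee_fin !mulr_ge0// subr_ge0; lra.
set r := fine X; have XE : X = r%:E by rewrite /r fineK.
have r0 : 0 <= r by rewrite -lee_fin -XE.
have If0 : 0 <= If by rewrite -lee_fin -fE; apply: integral_ge0 => s _; rewrite lee_fin.
have Ig0 : 0 <= Ig by rewrite -lee_fin -gE; apply: integral_ge0 => s _; rewrite lee_fin.
have : ((r * (y - x) + r * (y - x))%:E <= (If * Ig + Ig * If)%:E)%E.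
  rewrite -intfg// EFinD -[in X in (X + _)%E](integral_cst_itv _ (ltW xy)) [in X in (_ + X)%E]EFinM -[in X in (_ + X)%E]XE.
  rewrite /X -ge0_integralZr//; first last.
  - by rewrite lee_fin subr_ge0 ltW.
  - by move=> s _; rewrite lee_fin mulr_ge0.
  - exact: mfg'.
  rewrite -ge0_integralD//; first last.
  - by apply: emeasurable_funM => //; exact: mfg'.
  - by move=> s _; rewrite -EFinM lee_fin !mulr_ge0// subr_ge0 ltW.
  apply: ge0_le_integral => //.
  - by move=> s _; rewrite -EFinM -EFinD lee_fin addr_ge0// !mulr_ge0// subr_ge0 ltW.
  - apply: emeasurable_funD => //; apply: emeasurable_funM => //; exact: mfg'.
  - by apply/measurable_EFinP; apply: measurable_funD; apply: measurable_funM => //; [exact: mg|exact: mf].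
  - by move=> c cxy; have := Xle _ cxy; rewrite XE -EFinM -!EFinD !lee_fin; lra.
by rewrite XE !lee_fin ler_pdivlMr ?subr_gt0//; lra.
Qed.

End chebyshev.

(** * The L1 scheme and its fractional Gronwall inequality *)

Section L1_scheme.
Context {R : realType}.
Local Notation leb := (@lebesgue_measure R).
Variables (t : nat -> R) (alpha : R).
Hypothesis t0 : t 0%N = 0.
Hypothesis tS : forall n, t n < t n.+1.
Hypothesis step_nd : forall n, t n.+1 - t n <= t n.+2 - t n.+1.
Hypothesis alpha01 : 0 < alpha < 1.

Local Notation tau := (step_size t).
Local Notation K := (L1_coef t alpha).

Let alpha0 : 0 < alpha. Proof. by case/andP: alpha01. Qed.
Let alphaC0 : 0 < 1 - alpha. Proof. by rewrite subr_gt0; case/andP: alpha01. Qed.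
Let E2 : 1 - alpha + 1 = 2 - alpha. Proof. by ring. Qed.

Lemma node_le m n : (m <= n)%N -> t m <= t n.
Proof.
by move=> mn; apply: (@nondecreasing_seqP _ _ t).1 => // k; exact: ltW.
Qed.

Lemma node_ge0 n : 0 <= t n.
Proof. by rewrite -t0; exact: node_le. Qed.

Lemma node_gt0 n : (0 < n)%N -> 0 < t n.
Proof. by case: n => // n _; rewrite (le_lt_trans (node_ge0 n)). Qed.

Lemma step_gt0 n : (0 < n)%N -> 0 < tau n.
Proof. by case: n => // n _; rewrite subr_gt0. Qed.

Lemma step_le m n : (0 < m)%N -> (m <= n)%N -> tau m <= tau n.
Proof.
case: m n => // m [//|n] _; rewrite ltnS => mn.
by apply: (@nondecreasing_seqP _ _ (fun k => tau k.+1)).1.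
Qed.

Lemma integral_kernel_step n j : (0 < j <= n)%N ->
  (\int[leb]_(s in `]t j.-1, t j[) (kker (1 - alpha) (t n - s))%:E =
   (K n j * tau j)%:E)%E.
Proof.
case: j => // j /andP[_ jn].
rewrite /L1_coef /= mulrC mulrA divff ?mul1r ?gt_eqF ?step_gt0//.
rewrite integral_kker_reflect ?node_le// /Rintegral.
rewrite integral_itv_bndoo ?integral_kker_reflect ?node_le//.
by apply/measurable_EFinP; apply: measurable_kker; exact: measurable_funB.
Qed.

Lemma L1_coef_step n j : (0 < j <= n)%N ->
  K n j * tau j = kker (2 - alpha) (t n - t j.-1) - kker (2 - alpha) (t n - t j).
Proof.
move=> /[dup] jn /andP[j0 jn']; apply: EFin_inj; rewrite -integral_kernel_step//.
by rewrite (integral_kker_reflect alphaC0 (node_le (leq_pred j)) (node_le jn')) E2.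
Qed.

Lemma kker_nincr b (x y : R) : 0 < b <= 1 -> 0 < x -> x <= y -> kker b y <= kker b x.
Proof.
move=> /andP[b0 b1] x0 xy; rewrite ler_pM2r ?invr_gt0 ?Gamma_gt0//.
have -> : b - 1 = - (1 - b) by ring.
rewrite !powRN lef_pV2 ?posrE ?powR_gt0 ?(lt_le_trans x0)//.
apply: ge0_ler_powR; rewrite ?nnegrE ?subr_ge0//; first exact: ltW.
by rewrite (le_trans _ xy)// ltW.
Qed.

Lemma kker_ndecr b (x y : R) : 1 <= b -> 0 <= x -> x <= y -> kker b x <= kker b y.
Proof.
move=> b1 x0 xy.
rewrite ler_pM2r ?invr_gt0 ?Gamma_gt0 ?(lt_le_trans _ b1)//.
apply: ge0_ler_powR; rewrite ?nnegrE ?subr_ge0//.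
by rewrite (le_trans x0).
Qed.

Lemma L1_coef_ge0 n j : (0 < j <= n)%N -> 0 <= K n j.
Proof.
move=> jn; have /andP[j0 _] := jn; rewrite -(pmulr_lge0 _ (step_gt0 j0)).
rewrite -lee_fin -integral_kernel_step//; apply: integral_ge0 => s _.
by rewrite lee_fin kker_ge0.
Qed.

Let alphaC1 : 1 - alpha <= 1. Proof. by rewrite gerBl ltW. Qed.

Let measurable_kernel (c : R) (D : set R) :
  measurable_fun D (fun s => (kker (1 - alpha) (c - s))%:E).
Proof. by apply/measurable_EFinP; apply: measurable_kker; exact: measurable_funB. Qed.

(** The weight K(n, j) is the mean over the j-th interval of a kernel that
    increases towards t_n, hence at most its value at the right end t_j; the next
    weight is at least this value. *)
Lemma L1_coef_le_kernel n j : (0 < j < n)%N -> K n j <= kker (1 - alpha) (t n - t j).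
Proof.
case/andP=> j0 jn; have jn' := ltnW jn.
have tjn : t j < t n by rewrite (lt_le_trans (tS j))// node_le.
rewrite -(ler_pM2r (step_gt0 j0)) -lee_fin -integral_kernel_step ?j0// -integral_cst_itv; last first.
  by rewrite node_le// leq_pred.
apply: ge0_le_integral => //.
- by move=> s _; rewrite lee_fin kker_ge0.
- exact: measurable_kernel.
- move=> s /=; rewrite in_itv/= => /andP[_ sj]; rewrite lee_fin.
  by apply: kker_nincr; rewrite ?alphaC0 ?subr_gt0// lerB// ltW.
Qed.

Lemma L1_coef_ge_kernel n j : (0 < j < n)%N -> kker (1 - alpha) (t n - t j) <= K n j.+1.
Proof.
case/andP=> j0 jn.
have tjn : t j < t n by rewrite (lt_le_trans (tS j))// node_le.
rewrite -(@ler_pM2r _ (tau j.+1)) ?step_gt0// -lee_fin -integral_kernel_step// -integral_cst_itv; last first.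
  by rewrite ltW.
apply: ge0_le_integral => //.
- by move=> s _; rewrite lee_fin kker_ge0.
- exact: measurable_kernel.
- move=> s /=; rewrite in_itv/= => /andP[js sj]; rewrite lee_fin.
  have : s < t n by rewrite (lt_le_trans sj)// node_le.
  by move=> sn; apply: kker_nincr; rewrite ?alphaC0 ?subr_gt0// lerB// ltW.
Qed.

Lemma L1_coef_nd n j : (0 < j < n)%N -> K n j <= K n j.+1.
Proof. by move=> jn; apply: le_trans (L1_coef_le_kernel jn) (L1_coef_ge_kernel jn). Qed.

Lemma L1_coef_next n j : (0 < j <= n)%N -> K n.+1 j <= K n j.
Proof.
move=> /[dup] jn /andP[j0 jn'].
rewrite -(ler_pM2r (step_gt0 j0)) -lee_fin -!integral_kernel_step ?j0 ?leqW//.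
apply: ge0_le_integral => //.
- by move=> s _; rewrite lee_fin kker_ge0.
- exact: measurable_kernel.
- exact: measurable_kernel.
- move=> s /=; rewrite in_itv/= => /andP[js sj]; rewrite lee_fin.
  have sn : s < t n by rewrite (lt_le_trans sj)// node_le.
  by apply: kker_nincr; rewrite ?alphaC0 ?subr_gt0// lerB// ltW.
Qed.

Lemma L1_coef_diag n : (0 < n)%N ->
  K n n = (Gamma (2 - alpha) * tau n `^ alpha)^-1.
Proof.
move=> n0; have s0 := step_gt0 n0.
apply: (@mulIf _ (tau n)); first by rewrite gt_eqF.
rewrite L1_coef_step ?n0 ?leqnn// subrr /kker.
have -> : 2 - alpha - 1 = 1 - alpha by ring.
rewrite powR0 ?gt_eqF// mul0r subr0.
rewrite -[t n - _]/(tau n) powRB; last by rewrite (gt_eqF s0) implybT.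
rewrite powRr1 ?ltW//.
have G0 : 0 < Gamma (2 - alpha) by rewrite Gamma_gt0// -E2 addr_gt0.
by field; rewrite !gt_eqF ?powR_gt0.
Qed.

(** The discrete Caputo derivative is exact on the linear function t. *)
Lemma sum_L1_coef_step n : winc (K n) t n = kker (2 - alpha) (t n).
Proof.
transitivity (\sum_(1 <= j < n.+1) (kker (2 - alpha) (t n - t j.-1) - kker (2 - alpha) (t n - t j))).
  by apply: eq_big_nat => j jn; rewrite -L1_coef_step.
rewrite big_add1/=; under eq_bigr do rewrite -opprB.
rewrite sumrN telescope_sumr// subrr t0 subr0 opprB /kker.
rewrite (_ : 2 - alpha - 1 = 1 - alpha); last by ring.
by rewrite [X in _ - X * _]powR0 ?gt_eqF// mul0r subr0.
Qed.

(** Reduces a bound of a memory integral by a discrete derivative to one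
    interval at a time. *)
Lemma integral_mesh_le (F : R -> R) (c : nat -> R) n :
  (forall D : set R, measurable_fun D F) -> (forall s, 0 <= F s) ->
  (forall j, (0 < j <= n)%N -> (\int[leb]_(s in `]t j.-1, t j[) (F s)%:E <= (c j)%:E)%E) ->
  (\int[leb]_(s in `]0%R, t n[) (F s)%:E <= (\sum_(1 <= j < n.+1) c j)%:E)%E.
Proof.
move=> mF F0; have mF' D : measurable_fun D (EFin \o F) by apply/measurable_EFinP; exact: mF.
elim: n => [|n IH] Fc.
  by rewrite t0 set_itv_ge ?integral_set0 ?big_geq// bnd_simp ltxx.
rewrite (_ : `]0, t n.+1[%classic = `]0, t n] `|` `]t n, t n.+1[); last first.
  apply/seteqP; split=> s /=; rewrite !in_itv/=.
    by case/andP=> s0 sn; case: (leP s (t n)) => sn'; [left; rewrite s0|right].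
  case=> /andP[h1 h2]; last by rewrite h2 (le_lt_trans (node_ge0 n)).
  by rewrite h1 (le_lt_trans h2).
rewrite ge0_integral_setU//=; last first.
- rewrite disj_set2E; apply/eqP/seteqP; split=> // s [/=]; rewrite !in_itv/=.
  by move=> /andP[_ h1] /andP[h2 _]; move: (lt_le_trans h2 h1); rewrite ltxx.
- by move=> s _; rewrite lee_fin.
- exact: mF'.
rewrite big_nat_recr//= EFinD; apply: leeD; last exact: (Fc n.+1 (leqnn _)).
rewrite (@integral_itv_bndoo _ 0 (t n) _ false false); last exact: mF'.
by apply: IH => j /andP[j0 jn]; apply: Fc; rewrite j0 leqW.
Qed.

(** On each interval the memory kernel increases and the derivative of the power
    decreases, so by Chebyshev's inequality the integral of the product is at
    most what the L1 scheme computes from the two mean values. *)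
Lemma L1_kker_concave p n : 0 < p <= 1 -> (0 < n)%N ->
  kker (1 - alpha + p) (t n) <= winc (K n) (fun j => kker (p + 1) (t j)) n.
Proof.
move=> /andP[p0 p1] n0; rewrite -lee_fin -kker_convolution ?node_gt0//.
apply: integral_mesh_le => [D|s|j /[dup] jn /andP[j0 jn']].
- apply: measurable_funM; apply: measurable_kker; first exact: measurable_funB.
  exact: measurable_id.
- by rewrite mulr_ge0 ?kker_ge0.
have jlt : t j.-1 < t j by move: (step_gt0 j0); rewrite subr_gt0.
apply: le_trans (integral_chebyshev jlt _ _ _ _ _ (integral_kernel_step jn)
  (integral_kker p0 (node_ge0 _) (ltW jlt))) _ => //.
- by move=> D; apply: measurable_kker; exact: measurable_funB.
- by move=> D; apply: measurable_kker; exact: measurable_id.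
- by move=> s; exact: kker_ge0.
- by move=> s; exact: kker_ge0.
- have h a b : t j.-1 < a -> a <= b -> b < t j ->
    0 <= (kker (1 - alpha) (t n - b) - kker (1 - alpha) (t n - a)) * (kker p a - kker p b).
    move=> ja ab bj; rewrite mulr_ge0// subr_ge0.
      have bn : b < t n by rewrite (lt_le_trans bj)// node_le.
      by apply: kker_nincr; rewrite ?alphaC0 ?subr_gt0// lerB.
    by apply: kker_nincr; rewrite ?p0// (le_lt_trans (node_ge0 j.-1)).
  move=> a b; rewrite !in_itv/= => /andP[ja aj] /andP[jb bj].
  have [ab|/ltW ab] := leP a b; rewrite -oppr_ge0.
    by rewrite -mulNr opprB h.
  by rewrite -mulrN opprB h.
- rewrite lee_fin -[X in _ <= X]/(K n j * _); rewrite -[t j - _]/(tau j).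
  by rewrite mulrAC mulrK// unitfE gt_eqF// step_gt0.
Qed.

(** Here the derivative of the power increases.  Translating the memory integral
    at t_n by the step d = t_(n+1) - t_n turns it into an integral with the
    kernel of t_(n+1) and the derivative evaluated at s - d.  No step before is
    longer than d, so for s in the j-th interval s - d <= t_(j-1), where the
    derivative is below its mean over that interval. *)
Lemma L1_kker_convex p n : 1 <= p ->
  kker (1 - alpha + p) (t n) <= winc (K n.+1) (fun j => kker (p + 1) (t j)) n.+1.
Proof.
move=> p1; have p0 : 0 < p := lt_le_trans ltr01 p1.
set d := tau n.+1; have d0 : 0 < d := step_gt0 (ltn0Sn n).
(* the translated derivative, cut off at 0 so that it is defined on all of ]0, t n.+1[ *)
pose G s := kker p (Num.max (s - d) 0).
have G0 s : 0 <= G s by exact: kker_ge0.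
have mG D : measurable_fun D G.
  by apply: measurable_kker; apply: measurable_maxr => //; apply: measurable_funB.
rewrite -lee_fin.
have kmeas (c : R) (D : set R) : measurable_fun D (fun s => kker (1 - alpha) (c - s)).
  by apply: measurable_kker; exact: measurable_funB.
apply: (@le_trans _ _ (\int[leb]_(s in `]0%R, t n.+1[)
    (kker (1 - alpha) (t n.+1 - s) * G s)%:E)%E); last first.
  apply: integral_mesh_le => [D|s|j /[dup] jn /andP[j0 jn']].
  - by apply: measurable_funM.
  - by rewrite mulr_ge0 ?kker_ge0.
  have jlt : t j.-1 < t j by move: (step_gt0 j0); rewrite subr_gt0.
  apply: (@le_trans _ _ (K n.+1 j * tau j * kker p (t j.-1))%:E).
    rewrite EFinM -integral_kernel_step// -ge0_integralZr//; first last.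
    - by rewrite lee_fin kker_ge0.
    - by move=> s _; rewrite lee_fin kker_ge0.
    - exact: measurable_kernel.
    apply: ge0_le_integral => //.
    - by move=> s _; rewrite lee_fin mulr_ge0 ?kker_ge0.
    - by apply/measurable_EFinP; apply: measurable_funM; [exact: kmeas|exact: mG].
    - by apply: emeasurable_funM => //; exact: measurable_kernel.
    - move=> s /=; rewrite in_itv/= => /andP[_ sj].
      rewrite -EFinM lee_fin ler_wpM2l ?kker_ge0//; apply: kker_ndecr => //.
        by rewrite le_max lexx orbT.
      rewrite ge_max node_ge0 andbT lerBlDr.
      by have := step_le j0 jn'; rewrite -/d /step_size; lra.
  rewrite -mulrA lee_fin ler_wpM2l ?L1_coef_ge0//.
  rewrite -lee_fin -(integral_kker p0 (node_ge0 _) (ltW jlt)).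
  rewrite mulrC -(integral_cst_itv _ (ltW jlt)).
  apply: ge0_le_integral => //.
  - by move=> s _; rewrite lee_fin kker_ge0.
  - by apply/measurable_EFinP; apply: measurable_kker; exact: measurable_id.
  - move=> s /=; rewrite in_itv/= => /andP[js sj].
    by rewrite lee_fin; apply: kker_ndecr => //; [exact: node_ge0|exact: ltW].
have [n0|] := ltnP 0 n; last first.
  rewrite leqn0 => /eqP ->; rewrite t0 /kker powR0 ?mul0r; last first.
    by rewrite gt_eqF//; move: p1 alphaC0; lra.
  by apply: integral_ge0 => s _; rewrite lee_fin mulr_ge0 ?kker_ge0.
rewrite -kker_convolution ?node_gt0// (@ge0_integral_affine _ 1 (- d))//; first last.
- by move=> s _; rewrite lee_fin mulr_ge0 ?kker_ge0.
- apply/measurable_EFinP; apply: measurable_funM => //.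
  by apply: measurable_kker; exact: measurable_id.
rewrite mul1e (_ : _ @^-1` _ = `]d, t n.+1[%classic); last first.
  by apply/seteqP; split=> s /=; rewrite !in_itv/= mul1r subr_gt0 /d /step_size/=;
    move=> /andP[h1 h2]; apply/andP; split; lra.
apply: (@le_trans _ _ (\int[leb]_(s in `]d, t n.+1[)
    (kker (1 - alpha) (t n.+1 - s) * G s)%:E)%E).
  apply: ge0_le_integral => //.
  - by move=> s _; rewrite lee_fin mulr_ge0 ?kker_ge0.
  - apply/measurable_EFinP; apply: measurable_funM; apply: measurable_kker.
      by apply: measurable_funB => //; exact: measurable_affine.
    exact: measurable_affine.
  - by apply/measurable_EFinP; apply: measurable_funM; [exact: kmeas|exact: mG].
  - move=> s /=; rewrite in_itv/= => /andP[ds sn]; rewrite lee_fin mul1r.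
    have -> : t n - (s - d) = t n.+1 - s by rewrite /d /step_size/=; ring.
    by rewrite /G max_l// subr_ge0 ltW.
apply: ge0_subset_integral => //.
- by apply/measurable_EFinP; apply: measurable_funM; [exact: kmeas|exact: mG].
- by move=> s _; rewrite lee_fin mulr_ge0 ?kker_ge0.
- by move=> s /=; rewrite !in_itv/= => /andP[h ->]; rewrite (lt_trans d0).
Qed.

(** The discrete derivative of a power at t_(n+1) dominates its Caputo derivative
    at the previous node t_n. *)
Lemma L1_kker i n :
  kker (i%:R * alpha + 1) (t n) <=
  winc (K n.+1) (fun j => kker (i.+1%:R * alpha + 1) (t j)) n.+1.
Proof.
have p0 : 0 < i.+1%:R * alpha by rewrite mulr_gt0.
have -> : i%:R * alpha + 1 = 1 - alpha + i.+1%:R * alpha.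
  by rewrite -[i.+1]addn1 natrD; ring.
have [p1|p1] := leP (i.+1%:R * alpha) 1; last exact/L1_kker_convex/ltW.
apply: le_trans (L1_kker_concave _ _) => //; last by rewrite p0.
apply: kker_ndecr; rewrite ?node_ge0 ?node_le//.
by rewrite -[i.+1]addn1 natrD mulrDl mul1r addrCA addrC subrK lerDl mulr_ge0// ltW.
Qed.

(** On the term of index i + 1 of the series the Caputo derivative lowers the
    index by one and leaves a factor c.  The inequality holds for the partial
    sums and passes to the limit. *)
Lemma L1_mittag_leffler c n : 0 <= c ->
  c * mittag_leffler alpha (c * t n `^ alpha) <=
  winc (K n.+1) (fun j => mittag_leffler alpha (c * t j `^ alpha)) n.+1.
Proof.
move=> c0; pose S J (j : nat) : R := series (ml_term alpha (c * t j `^ alpha)) J.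
have cS j : S J j @[J --> \oo] --> mittag_leffler alpha (c * t j `^ alpha).
  by apply: is_cvg_ml => //; rewrite mulr_ge0 ?powR_ge0.
have SE J j : S J j = \sum_(0 <= i < J) c ^+ i * kker (i%:R * alpha + 1) (t j).
  rewrite /S /series/=; apply: eq_bigr => i _.
  by rewrite /ml_term /kker addrK exprMn -(powR_mulrn i (powR_ge0 (t j) alpha)) -powRrM [alpha * _]mulrC mulrA.
(* the term of index 0 is constant, so it drops out of the increments *)
have step J : c * S J n <= winc (K n.+1) (S J.+1) n.+1.
  rewrite (@eq_winc _ _ _ (fun j => 1 + \sum_(0 <= i < J) c ^+ i.+1 *
      kker (i.+1%:R * alpha + 1) (t j))); last first.
    move=> j _; rewrite SE big_nat_recl//= expr0 mul0r add0r mul1r /kker subrr.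
    by rewrite powRr0 Gamma1 divr1.
  rewrite wincD winc_cst add0r SE mulr_sumr {1}/winc.
  under [leRHS]eq_bigr do rewrite -sumrB mulr_sumr.
  rewrite exchange_big/=; apply: ler_sum => i _.
  under [leRHS]eq_bigr do rewrite -mulrBr mulrCA.
  rewrite -mulr_sumr mulrA -exprS ler_wpM2l ?exprn_ge0//.
  exact: L1_kker.
have c1 : c * S J n @[J --> \oo] --> c * mittag_leffler alpha (c * t n `^ alpha).
  by apply: cvgM => //; exact: cvg_cst.
have c2 m : winc (K n.+1) (S J.+1) m @[J --> \oo] -->
    winc (K n.+1) (fun j => mittag_leffler alpha (c * t j `^ alpha)) m.
  elim: m => [|m IH].
    under eq_fun do rewrite winc0.
    by rewrite winc0; exact: cvg_cst.
  under eq_fun do rewrite wincS.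
  rewrite wincS; apply: cvgD => //; apply: cvgM; first exact: cvg_cst.
  by apply: cvgB; rewrite (cvg_shiftS (S^~ _)).
by apply: ler_cvg_to c1 (c2 _) _; near=> J; exact: step.
Unshelve. all: by end_near. Qed.

(** Replacing the newest value by 0 gives a sequence to which the maximum
    principle applies, and changes the sum by the positive weight K(n, n) times
    that value. *)
Lemma L1_comparison e n : winc (K n.+1) e n.+1 <= 0 ->
  (forall j, (j <= n)%N -> e j <= 0) -> e n.+1 <= 0.
Proof.
move=> we ej; pose e' j := if (j <= n)%N then e j else 0.
have : 0 <= winc (K n.+1) e' n.+1.
  apply: winc_max_principle => //.
  - by rewrite L1_coef_ge0.
  - by move=> j; exact: L1_coef_nd.
  - by rewrite /e' ltnn.
  - by move=> j; rewrite ltnS /e' => jn; rewrite jn ej.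
have -> : winc (K n.+1) e' n.+1 = winc (K n.+1) e n.+1 - K n.+1 n.+1 * e n.+1.
  rewrite !wincS {2 3}/e' ltnn leqnn (@eq_winc _ _ e' e).
    by ring.
  by move=> j jn; rewrite /e' jn.
have K0 : 0 < K n.+1 n.+1.
  rewrite L1_coef_diag// invr_gt0 mulr_gt0 ?powR_gt0 ?step_gt0// Gamma_gt0//.
  by rewrite -E2 addr_gt0.
by move=> h; rewrite -(pmulr_rle0 _ K0); lra.
Qed.

Fixpoint running_max (q : nat -> R) n : R :=
  if n is m.+1 then Num.max (running_max q m) (q m.+1) else q 0%N.

Lemma running_max_ge q n j : (j <= n)%N -> q j <= running_max q n.
Proof.
elim: n => [|n IH]; first by rewrite leqn0 => /eqP ->.
rewrite leq_eqVlt => /predU1P[->|]; first by rewrite /= le_max lexx orbT.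
by rewrite ltnS => /IH h; rewrite /= le_max h.
Qed.

(** If the maximum is attained at the newest index, pass from q to its running
    maximum by the maximum principle.  Otherwise the newest increment vanishes
    and the older weights decrease from one time level to the next. *)
Lemma L1_running_max q lam F m : 0 <= lam -> 0 <= F -> 0 <= q 0%N ->
  (forall n, (0 < n <= m)%N -> winc (K n) q n <= lam * running_max q n + F) ->
  forall n, (0 < n <= m)%N ->
    winc (K n) (running_max q) n <= lam * running_max q n + F.
Proof.
move=> lam0 F0 q0 hq; elim=> // n IH /= nm.
have M0 k : 0 <= running_max q k by apply: le_trans (running_max_ge q (leq0n k)).
have [Mq|qM] := leP (running_max q n) (q n.+1).
  apply: le_trans (winc_le _ _ _ _ _) _; [| | | | |have := hq n.+1 nm].
  - by [].
  - by rewrite L1_coef_ge0.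
  - by move=> j; exact: L1_coef_nd.
  - by rewrite /= max_r.
  - by move=> j jn; exact: running_max_ge.
  - by rewrite /= max_r.
rewrite wincS /= (max_l (ltW qM)) subrr mulr0 addr0.
case: n IH nm qM => [_ _ _|n IH nm qM].
  by rewrite winc0 addr_ge0// mulr_ge0.
apply: le_trans (winc_le_weight (w := K n.+1) _ _) _.
- by move=> j jn; exact: L1_coef_next.
- by case=> // j _; rewrite /= le_max lexx.
- by apply: IH; exact: ltnW.
Qed.

(** For the running maximum M the step restriction absorbs the newest value; then
    Z = M + 2 F (B - k), where k is the fractional integral of order alpha of the
    constant 1 and B its value at t_m, satisfies the homogeneous inequality, and Z lies
    below Z_0 times the Mittag-Leffler function.  At t_m, Z and M agree. *)
Lemma L1_gronwall q lam F m : 0 <= lam -> 0 <= F -> 0 <= q 0%N ->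
  (forall n, (0 < n <= m)%N -> 2 * lam <= K n n) ->
  (forall n, (0 < n <= m)%N -> winc (K n) q n <= lam * running_max q n + F) ->
  q m <= mittag_leffler alpha (2 * lam * t m `^ alpha) *
         (q 0%N + 2 * F * kker (alpha + 1) (t m)).
Proof.
move=> lam0 F0 q0 hlam hq; set M := running_max q.
have M0 k : 0 <= M k by apply: le_trans (running_max_ge q (leq0n k)).
have MS k : M k <= M k.+1 by rewrite /= le_max lexx.
(* the newest increment of M enters with factor lam on the right and at least 2 lam on the left *)
have hM n : (n < m)%N -> winc (K n.+1) M n.+1 <= 2 * lam * M n + 2 * F.
  move=> nm; have := @L1_running_max q lam F m lam0 F0 q0 hq n.+1 nm; rewrite -/M wincS.
  have h0 : 0 <= winc (K n.+1) M n.
    rewrite /winc big_nat; apply: sumr_ge0 => j /andP[j1 jn].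
    rewrite mulr_ge0 ?subr_ge0 ?L1_coef_ge0// ?j1 ?leqW//.
    by case: j j1 {jn} => // j _; exact: MS.
  have := hlam n.+1 nm; have := MS n; have := M0 n; nra.
set B := kker (alpha + 1) (t m).
have Bge n : (n <= m)%N -> kker (alpha + 1) (t n) <= B.
  by move=> nm; apply: kker_ndecr; rewrite ?node_ge0 ?node_le// lerDr ltW.
pose Z j := M j + 2 * F * (B - kker (alpha + 1) (t j)).
pose W j := mittag_leffler alpha (2 * lam * t j `^ alpha).
have kk0 : kker (alpha + 1) (t 0%N) = 0.
  by rewrite t0 /kker addrK powR0 ?mul0r ?gt_eqF.
have Z0E : Z 0%N = q 0%N + 2 * F * B by rewrite /Z kk0 subr0.
have Z0 : 0 <= Z 0%N by rewrite Z0E addr_ge0//; apply: mulr_ge0; [exact: mulr_ge0|apply: kker_ge0; exact: addr_gt0].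
have hZ n : (n < m)%N -> winc (K n.+1) Z n.+1 <= 2 * lam * Z n.
  move=> nm.
  have -> : winc (K n.+1) Z n.+1 = winc (K n.+1) M n.+1 -
      2 * F * winc (K n.+1) (fun j => kker (alpha + 1) (t j)) n.+1.
    rewrite /Z wincD wincZ; congr (_ + _); rewrite -mulrN; congr (_ * _).
    rewrite (@eq_winc _ _ _ (fun j => B + (-1) * kker (alpha + 1) (t j))); last first.
      by move=> j _; rewrite mulN1r.
    by rewrite wincD winc_cst add0r wincZ mulN1r.
  have := L1_kker 0 n; rewrite mul0r add0r mul1r {1}/kker subrr powRr0 Gamma1 divr1.
  set w := winc _ _ _ => w1; have hMn := hM n nm; have Bn := Bge n (ltnW nm).
  have Fw : 2 * F <= 2 * F * w by rewrite ler_peMr// mulr_ge0.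
  have : 0 <= 2 * lam * (2 * F * (B - kker (alpha + 1) (t n))).
    by rewrite !mulr_ge0// subr_ge0.
  by rewrite /Z mulrDr; lra.
have ZW n : (n <= m)%N -> Z n - Z 0%N * W n <= 0.
  elim/ltn_ind: n => -[_ _|n IH nm].
    rewrite subr_le0 ler_peMr// /W mittag_leffler_ge1// mulr_ge0 ?powR_ge0//.
    by rewrite mulr_ge0.
  apply: (@L1_comparison (fun n => Z n - Z 0%N * W n)); last first.
    by move=> j jn; apply: IH => //; rewrite (leq_trans jn)// ltnW.
  rewrite (@eq_winc _ _ _ (fun j => Z j + (- Z 0%N) * W j)); last first.
    by move=> j _; rewrite mulNr.
  rewrite wincD wincZ.
  have hW := @L1_mittag_leffler (2 * lam) n (mulr_ge0 (ler0n _ 2) lam0).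
  have hZn := hZ n nm; have := IH n (ltnSn n) (ltnW nm).
  have : Z 0%N * (2 * lam * W n) <= Z 0%N * winc (K n.+1) W n.+1 by rewrite ler_wpM2l.
  rewrite -/(W n) in hW; set w := winc _ W _ => h1 h2.
  have : 2 * lam * (Z n - Z 0%N * W n) <= 0 by rewrite mulr_ge0_le0// mulr_ge0.
  by nra.
apply: le_trans (running_max_ge q (leqnn m)) _.
have := ZW m (leqnn m); rewrite Z0E {1}/Z subrr mulr0 addr0 subr_le0.
by rewrite mulrC.
Qed.

End L1_scheme.

(** * The space L2 *)

Section L2_space.
Context {R : realType} {d : nat} (Om : set 'cV[R]_d).
Hypothesis mOm : measurable Om.
Local Notation leb := (@lebesgue_cV R d).
Local Notation "'[ f , g ]" := (ipL2 Om f g).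
Implicit Types f g : 'cV[R]_d -> R.

Lemma inL2_integrableM f g : inL2 Om f -> inL2 Om g ->
  leb.-integrable Om (fun x => (f x * g x)%:E).
Proof.
move=> [mf f2] [mg g2].
apply: (@le_integrable _ _ _ leb Om mOm _ (fun x => ((f x ^+ 2)%:E + (g x ^+ 2)%:E)%E)).
- by apply/measurable_EFinP; exact: measurable_funM.
- move=> x _; rewrite -EFinD !abse_EFin lee_fin (ger0_norm (addr_ge0 _ _)) ?sqr_ge0//.
  by rewrite ler_norml; apply/andP; split; nra.
- exact: integrableD.
Qed.

Lemma ipL2_comb (a b : R) f g : inL2 Om f -> inL2 Om g ->
  '[fun x => a * f x + b * g x, fun x => a * f x + b * g x] =
  a ^+ 2 * '[f, f] + 2 * a * b * '[f, g] + b ^+ 2 * '[g, g].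
Proof.
move=> f2 g2; have iff := inL2_integrableM f2 f2.
have ifg := inL2_integrableM f2 g2; have igg := inL2_integrableM g2 g2.
have iZ (c : R) (h : 'cV[R]_d -> R) : leb.-integrable Om (EFin \o h) ->
    leb.-integrable Om (EFin \o (fun x => c * h x)).
  by move=> ih; apply: eq_integrable (integrableZl _ c ih).
rewrite /ipL2 -!RintegralZl// -!RintegralD//; first last.
- exact: iZ.
- exact: iZ.
- exact: iZ.
- apply: eq_integrable (integrableD mOm (iZ (a ^+ 2) _ iff) (iZ (2 * a * b) _ ifg)) => //.
- by apply: eq_Rintegral => x _; ring.
Qed.

Lemma ipL2_ge0 f : 0 <= '[f, f].
Proof. by apply: Rintegral_ge0 => x _; rewrite -expr2 sqr_ge0. Qed.

Lemma normL2_ge0 f : 0 <= normL2 Om f.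
Proof. exact: sqrtr_ge0. Qed.

Lemma sqr_normL2 f : normL2 Om f ^+ 2 = '[f, f].
Proof. by rewrite sqr_sqrtr// ipL2_ge0. Qed.

(** The quadratic form a^2 [f, f] + 2 a b [f, g] + b^2 [g, g] is nonnegative, so
    its discriminant is not positive. *)
Lemma ipL2_cauchy_schwarz f g : inL2 Om f -> inL2 Om g ->
  `|'[f, g]| <= normL2 Om f * normL2 Om g.
Proof.
move=> f2 g2; set F := '[f, f]; set G := '[g, g]; set I := '[f, g].
have h (a b : R) : 0 <= a ^+ 2 * F + 2 * a * b * I + b ^+ 2 * G.
  by rewrite -ipL2_comb//; exact: ipL2_ge0.
have F0 : 0 <= F by exact: ipL2_ge0.
have G0 : 0 <= G by exact: ipL2_ge0.
have : I ^+ 2 <= F * G.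
  have [G_eq0|Gneq0] := eqVneq G 0; last first.
    have Gp : 0 < G by rewrite lt_def Gneq0.
    rewrite -subr_ge0 -(pmulr_rge0 _ Gp); suff -> : G * (F * G - I ^+ 2) =
      G ^+ 2 * F + 2 * G * (- I) * I + (- I) ^+ 2 * G by exact: h.
    by ring.
  suff -> : I = 0 by rewrite expr0n/= mulr_ge0.
  (* with G = 0 the form is affine in b; this b makes it equal to -1 *)
  apply/eqP/negPn/negP => I0; have := h 1 (- (F + 1) / (2 * I)).
  have -> : 1 ^+ 2 * F + 2 * 1 * (- (F + 1) / (2 * I)) * I + (- (F + 1) / (2 * I)) ^+ 2 * G = -1.
    by rewrite G_eq0; field.
  lra.
rewrite /normL2 -sqrtrM// => IFG.
rewrite -sqrtr_sqr; exact: ler_wsqrtr.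
Qed.

Lemma sqr_normL2_sub_le (a b : R) f g : inL2 Om f -> inL2 Om g ->
  normL2 Om (fun x => a * f x - b * g x) ^+ 2 <=
  2 * (a ^+ 2 * normL2 Om f ^+ 2 + b ^+ 2 * normL2 Om g ^+ 2).
Proof.
move=> f2 g2; have e x : a * f x - b * g x = a * f x + (- b) * g x by ring.
under [X in normL2 _ X]eq_fun do rewrite e.
rewrite !sqr_normL2 ipL2_comb//.
have := ipL2_comb a b f2 g2; have := ipL2_ge0 (fun x => a * f x + b * g x).
by move=> + E; rewrite E; nra.
Qed.

End L2_space.

(** * Polytopal domains have finite measure *)

Section lebesgue_cV_bounded.
Context {R : realType}.

Lemma cV_norm_coord (d : nat) (x : 'cV[R]_d) (i : 'I_d) : `|x i 0| <= `|x|.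
Proof.
have -> : `|x| = mx_norm x by [].
by rewrite mx_normrE (le_bigmax _ (fun ij : 'I_d * 'I_1 => `|x ij.1 ij.2|) (i, 0)).
Qed.

Definition cube (d : nat) (M : R) : set 'cV[R]_d := [set x | forall i, `|x i 0| <= M].
Arguments cube d M : clear implicits.

Lemma measurable_half_space d (h : 'cV[R]_d -> R) (c : R) :
  measurable_fun setT h -> measurable [set x | h x < c] /\ measurable [set x | h x <= c].
Proof.
move=> mh; split.
  have -> : [set x | h x < c] = h @^-1` `]-oo, c[.
    by apply/seteqP; split=> x /=; rewrite in_itv.
  by rewrite -[X in measurable X]setTI; apply: mh.
have -> : [set x | h x <= c] = h @^-1` `]-oo, c].
  by apply/seteqP; split=> x /=; rewrite in_itv.
by rewrite -[X in measurable X]setTI; apply: mh.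
Qed.

Lemma measurable_finite_forall d m (P : 'I_m -> set 'cV[R]_d) :
  (forall i, measurable (P i)) -> measurable [set x | forall i, P i x].
Proof.
move=> mP; have -> : [set x | forall i, P i x] = \big[setI/setT]_(i < m) P i.
  apply/seteqP; split=> x /=.
    by move=> h; elim/big_rec: _ => //= i A _ Ax; split.
  move=> + i; rewrite (bigD1 i)//=; by case.
by apply: big_ind => //; exact: measurableI.
Qed.

Lemma measurable_cube d M : measurable (cube d M).
Proof.
apply: measurable_finite_forall => i.
apply: (measurable_half_space M _).2; apply: measurableT_comp => //.
exact: measurable_coord_cV.
Qed.

(** By induction on the dimension, since the measure is an iterated product. *)
Lemma lebesgue_cube_lty d M : (lebesgue_cV d (cube d M) < +oo)%E.
Proof.
elim: d => [|d IH] /=.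
  by rewrite /dirac indicE; case: (_ \in _); rewrite ltry.
rewrite /lebesgue_cV_ext /pushforward.
have -> : (@cons_cV R d) @^-1` (cube d.+1 M) = `[- M, M]%classic `*` cube d M.
  have e := @cons_cVK R d.
  apply/seteqP; split=> -[a v] /=.
    move=> h; split=> /=.
      have := h ord0; have := e (a, v); rewrite /uncons_cV => -[-> _].
      by rewrite in_itv/= ler_norml.
    move=> i; have := h (lift ord0 i); have := e (a, v); rewrite /uncons_cV => -[_ ev].
    by rewrite -[v in X in _ -> X]ev mxE.
  rewrite in_itv/= => -[av hv] i.
  have := e (a, v); rewrite /uncons_cV => -[e1 e2].
  case: (unliftP ord0 i) => [j ->|->]; last by rewrite e1 ler_norml.
  by have := hv j; rewrite -[v in X in X -> _]e2 mxE.
rewrite [X in (X < _)%E](_ : _ = @lebesgue_measure R `[(- M)%R, M]%classic *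
    lebesgue_cV d (cube d M))%E; last first.
  by apply: product_measure1E => //; exact: measurable_cube.
rewrite lte_mul_pinfty// ?ge0_fin_numE// (lebesgue_measure_itv `[(- M), M])/=.
by case: ifP => _; rewrite ?ltry.
Qed.

Lemma polytope_measurable d (Om : set 'cV[R]_d) :
  convex_polytopal_domain Om -> measurable Om.
Proof.
move=> [_ _ [m [nu [kappa ->]]]]; apply: measurable_finite_forall => k.
apply: (measurable_half_space _ _).1; apply: measurable_sum => i.
by apply: measurable_funM => //; exact: measurable_coord_cV.
Qed.

Lemma polytope_lebesgue_lty d (Om : set 'cV[R]_d) :
  convex_polytopal_domain Om -> (lebesgue_cV d Om < +oo)%E.
Proof.
move=> /[dup] /polytope_measurable mOm [_ [M [_ hM]] _].
apply: le_lt_trans (lebesgue_cube_lty d (M + 1)).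
apply: le_measure; rewrite ?inE//; first exact: measurable_cube.
move=> x Ox i; apply: le_trans (cV_norm_coord _ _) _.
by apply: hM => //; rewrite ltrDl.
Qed.

End lebesgue_cV_bounded.

(** * The integral operator on L2 *)

Section integral_operator.
Context {R : realType} {d : nat} (Om : set 'cV[R]_d).
Hypothesis mOm : measurable Om.
Hypothesis Omoo : (lebesgue_cV d Om < +oo)%E.
Local Notation leb := (@lebesgue_cV R d).
Implicit Types f : 'cV[R]_d -> R.

Lemma inL2_integrable f : inL2 Om f -> leb.-integrable Om (EFin \o f).
Proof.
move=> [mf f2].
have i1 : leb.-integrable Om (EFin \o cst (1 : R)).
  apply/integrableP; split; first exact/measurable_EFinP.
  rewrite (_ : (fun x => _) = cst 1%E); last by apply/funext => x; rewrite /= normr1.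
  by rewrite integral_cst// mul1e.
apply: (@le_integrable _ _ _ leb Om mOm _ (fun x => ((cst (1 : R) x)%:E + (f x ^+ 2)%:E)%E)).
- exact/measurable_EFinP.
- move=> x _; rewrite -EFinD !abse_EFin lee_fin [leRHS]ger0_norm ?addr_ge0 ?sqr_ge0//=.
  by rewrite ler_norml; apply/andP; split; nra.
- exact: integrableD.
Qed.

(** The measure of a product null set is the integral of the measures of its
    sections. *)
Lemma negligible_xsection (P : 'cV[R]_d * 'cV[R]_d -> Prop) :
  {ae (leb \x leb)%E, forall z, P z} ->
  {ae leb, forall x, {ae leb, forall y, P (x, y)}}.
Proof.
move=> [N [mN N0 PN]].
have : (\int[leb]_x `|leb (xsection N x)| = 0)%E.
  by rewrite -[RHS]N0; apply: eq_integral => x _; rewrite gee0_abs.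
move/(ae_eq_integral_abs leb measurableT (measurable_fun_xsection leb mN)).
apply: filterS => x /= /(_ I) Nx.
exists (xsection N x); split=> //; first exact: measurable_xsection.
by move=> y /= Pxy; rewrite /xsection/= inE; exact: PN.
Qed.

(** Measurability comes from Tonelli's theorem applied to the positive and
    negative parts of the integrand.  For almost every x the section of g is
    bounded almost everywhere, so the image is bounded by a multiple of the L1
    norm of f, and a bounded function on a set of finite measure is in L2. *)
Lemma int_op_inL2 (g : 'cV[R]_d * 'cV[R]_d -> R) f :
  inLinf2 Om g -> inL2 Om f -> inL2 Om (int_op Om g f).
Proof.
move=> [mg [M gM]] f2; have [mf _] := f2.
have mOm2 : measurable (Om `*` Om) by exact: measurableX.
pose h (z : 'cV[R]_d * 'cV[R]_d) := f z.2 * g z.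
have mh : measurable_fun (Om `*` Om) h.
  apply: measurable_funM => //.
  have := @measurable_comp _ _ _ _ _ _ Om f (Om `*` Om) snd mOm.
  apply=> //; first by move=> _ [z [_ ?] <-].
  exact: measurable_funS measurable_snd.
pose H := (EFin \o h) \_ (Om `*` Om).
have mH : measurable_fun setT H by apply/(measurable_restrictT _ mOm2)/measurable_EFinP.
have HE x : Om x -> (\int[leb]_y H (x, y) = \int[leb]_(y in Om) (f y * g (x, y))%:E)%E.
  move=> Ox; rewrite [RHS]integral_mkcond; apply: eq_integral => y _.
  rewrite /H !patchE; congr (if _ then _ else _); apply/idP/idP; rewrite !inE/=.
    by case.
  by split.
have mI : measurable_fun setT (fun x => \int[leb]_y H (x, y))%E.
  rewrite (_ : (fun x => _) = (fun x => fubini_F leb H^\+ x - fubini_F leb H^\- x)%E).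
    apply: emeasurable_funB; apply: measurable_fun_fubini_tonelli_F => //.
      exact: measurable_funepos.
    exact: measurable_funeneg.
  by apply/funext => x; rewrite integralE /fubini_F; congr (_ - _)%E;
    apply: eq_integral => y _; rewrite ?funeposE ?funenegE.
have mop : measurable_fun Om (int_op Om g f).
  apply: (eq_measurable_fun (fine \o (fun x => \int[leb]_y H (x, y))%E)).
    by move=> x /set_mem Ox /=; rewrite HE.
  apply: measurable_funTS; apply: measurableT_comp => //.
split=> //.
have fi := inL2_integrable f2.
pose C := \int[leb]_(y in Om) (`|M| * `|f y|).
have iMf : leb.-integrable Om (EFin \o (fun y => `|M| * `|f y|)).
  by apply: eq_integrable (integrableZl mOm `|M| (integrable_norm fi)).
have op_bd : {ae leb, forall x, Om x -> `|int_op Om g f x| <= C}.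
  move/negligible_xsection : gM; apply: filterS => x gx Ox.
  have mfg : measurable_fun Om (fun y => f y * g (x, y)).
    apply: measurable_funM => //.
    have mx : measurable_fun setT (pair x : 'cV[R]_d -> 'cV[R]_d * 'cV[R]_d).
      exact: measurable_pair1.
    have := @measurable_comp _ _ _ _ _ _ (Om `*` Om) g Om (pair x) mOm2.
    apply=> //; first by move=> _ [y Oy <-].
    exact: measurable_funTS.
  have bd : (`|\int[leb]_(y in Om) (f y * g (x, y))%:E| <= C%:E)%E.
    apply: le_trans (le_abse_integral _ mOm _) _; first exact/measurable_EFinP.
    rewrite /C /Rintegral fineK; last exact: integrable_fin_num.
    apply: ae_ge0_le_integral => //.
    - by apply: measurableT_comp => //; exact/measurable_EFinP.
    - exact: measurable_int iMf.
    - move: gx; apply: filterS => y gy Oy; rewrite abse_EFin lee_fin normrM mulrC.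
      by rewrite ler_wpM2r// (le_trans (gy _))// ler_norm.
  have : (\int[leb]_(y in Om) (f y * g (x, y))%:E \is a fin_num)%E.
    by rewrite fin_num_abs (le_lt_trans bd) ?ltry.
  rewrite /int_op /Rintegral => /fineK E; move: bd.
  by rewrite -E abse_EFin lee_fin.
apply/integrableP; split.
  by apply/measurable_EFinP; exact: measurable_funX.
apply: (@le_lt_trans _ _ (\int[leb]_(x in Om) (C ^+ 2)%:E)%E); last first.
  by rewrite integral_cst// lte_mul_pinfty// ?lee_fin ?sqr_ge0// ?ge0_fin_numE.
apply: ae_ge0_le_integral => //.
- by apply: measurableT_comp => //; apply/measurable_EFinP; exact: measurable_funX.
- by move=> x _; rewrite lee_fin sqr_ge0.
- move: op_bd; apply: filterS => x h1 Ox; rewrite abse_EFin lee_fin normrX.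
  by rewrite lerXn2r ?nnegrE ?h1// (le_trans _ (h1 Ox)).
Qed.

End integral_operator.

(** * The principal bilinear form *)

Section form_a0.
Context {R : realType} {d : nat} (Om : set 'cV[R]_d).
Hypothesis mOm : measurable Om.
Local Notation leb := (@lebesgue_cV R d).
Variables (A : 'cV[R]_d -> R -> 'M[R]_d) (b : 'cV[R]_d -> R -> 'cV[R]_d)
  (c : 'cV[R]_d -> R -> R) (T : R).
Hypothesis hcoef : coefficients Om A b c T.
Implicit Types phi psi chi : fgrad R d.
Local Notation a0 := (form_a0 Om A).

Lemma dotv_sym (S : 'M[R]_d) (x y : 'cV[R]_d) : S^T = S ->
  dotv (S *m x) y = dotv (S *m y) x.
Proof.
move=> ST; transitivity (\sum_i \sum_j S i j * x j 0 * y i 0).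
  by apply: eq_bigr => i _; rewrite mxE mulr_suml.
rewrite exchange_big/=; apply: eq_bigr => j _; rewrite mxE mulr_suml.
by apply: eq_bigr => i _; rewrite -[in LHS]ST mxE; ring.
Qed.

(** The coefficients are bounded almost everywhere and the product of two
    gradient components is integrable. *)
Lemma integrable_form_a0 t phi psi : 0 < t <= T -> inH1 Om phi -> inH1 Om psi ->
  leb.-integrable Om (EFin \o (fun x => dotv (A x t *m phi.2 x) (psi.2 x))).
Proof.
move=> t0T [_ phi2 _] [_ psi2 _].
have [M hM] := coef_bounded hcoef.
have t0T' : 0 <= t <= T by case/andP: t0T => /ltW -> ->.
have iij i j : leb.-integrable Om (EFin \o (fun x => A x t i j * (phi.2 x j 0 * psi.2 x i 0))).
  have ipq := inL2_integrableM mOm (phi2 j) (psi2 i).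
  have mpq : measurable_fun Om (fun x => phi.2 x j 0 * psi.2 x i 0).
    by apply/measurable_EFinP; exact: measurable_int ipq.
  have mA := coef_measA hcoef i j t0T'.
  apply/integrableP; split.
    by apply/measurable_EFinP; exact: measurable_funM.
  have := integrableZl mOm `|M| (integrable_norm ipq).
  case/integrableP => mm; apply: le_lt_trans.
  apply: ae_ge0_le_integral => //.
  - apply: measurableT_comp => //; apply/measurable_EFinP; exact: measurable_funM.
  - exact: measurableT_comp.
  - move: hM; apply: filterS => x hx Ox /=; have [hA _ _] := hx Ox t t0T.
    rewrite lee_fin !normrM !normr_id -normrM ler_wpM2r//.
    by rewrite (le_trans (hA i j))// ler_norm.
apply: (@eq_integrable _ _ _ leb Om mOm (fun x =>
   (\sum_(i < d) \sum_(j < d) (A x t i j * (phi.2 x j 0 * psi.2 x i 0))%:E)%E)).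
  move=> x _; rewrite /= /dotv -sumEFin; apply: eq_bigr => i _.
  by rewrite sumEFin mxE mulr_suml; congr EFin; apply: eq_bigr => j _; rewrite mulrA.
apply: integrable_sum => // i _; apply: integrable_sum => // j _.
exact: iij.
Qed.

Lemma form_a0_sym t phi psi : 0 < t <= T -> inH1 Om phi -> inH1 Om psi ->
  a0 t phi psi = a0 t psi phi.
Proof.
move=> t0T phiH psiH; rewrite /form_a0 /Rintegral; congr fine.
apply: ae_eq_integral => //.
- exact: measurable_int (integrable_form_a0 t0T phiH psiH).
- exact: measurable_int (integrable_form_a0 t0T psiH phiH).
- move: (coef_sym hcoef); apply: filterS => x hx Ox.
  by congr EFin; apply: dotv_sym; exact: hx.
Qed.

Lemma form_a0_linear t (k : R) phi psi chi : 0 < t <= T ->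
  inH1 Om phi -> inH1 Om psi -> inH1 Om chi ->
  a0 t phi (k *: psi + chi) = k * a0 t phi psi + a0 t phi chi.
Proof.
move=> t0T phiH psiH chiH.
have i1 := integrable_form_a0 t0T phiH psiH.
have i2 := integrable_form_a0 t0T phiH chiH.
rewrite /form_a0 -RintegralZl// -RintegralD//; last first.
  by apply: eq_integrable (integrableZl mOm k i1).
apply: eq_Rintegral => x _; rewrite /dotv mulr_sumr -big_split/=.
apply: eq_bigr => i _; rewrite mulrCA -mulrDr; congr (_ * _).
by rewrite !mxE.
Qed.

End form_a0.

(** * Graded meshes *)

Section graded_mesh.
Context {R : realType}.
Variables (T gamma : R) (N : nat).
Hypothesis T0 : 0 < T.
Hypothesis gamma1 : 1 <= gamma.
Hypothesis N0 : (0 < N)%N.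
Local Notation t := (mesh T gamma N).

Let gamma0 : 0 < gamma. Proof. exact: lt_le_trans gamma1. Qed.
Let N0' : 0 < N%:R :> R. Proof. by rewrite ltr0n. Qed.

Lemma mesh0 : t 0%N = 0.
Proof. by rewrite /mesh mul0r powR0 ?mul0r// gt_eqF. Qed.

Lemma mesh_lt n : t n < t n.+1.
Proof.
rewrite /mesh ltr_pM2r//; apply: gt0_ltr_powR => //;
  rewrite ?nnegrE ?divr_ge0//.
by rewrite ltr_pM2r ?invr_gt0// ltr_nat.
Qed.

Lemma mesh_le n : (n <= N)%N -> 0 <= t n <= T.
Proof.
move=> nN; rewrite /mesh mulr_ge0 ?powR_ge0 ?(ltW T0)//=.
rewrite -[leRHS]mul1r ler_pM2r//.
apply: (@le_trans _ _ (1 `^ gamma)); last by rewrite powR1.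
apply: ge0_ler_powR; rewrite ?nnegrE ?divr_ge0//; first exact: ltW.
by rewrite ler_pdivrMr// mul1r ler_nat.
Qed.

Lemma powR_midpoint (x y : R) : 0 <= x -> 0 <= y ->
  2 * ((x + y) / 2) `^ gamma <= x `^ gamma + y `^ gamma.
Proof.
move=> x0 y0.
have h0 : 0 <= 2^-1 :> R by rewrite invr_ge0.
have h1 : 2^-1 <= 1 :> R by rewrite invf_le1// ler1n.
have := @convex_powR R gamma gamma1 (Itv01 h0 h1) x y.
have in0 (z : R) : 0 <= z -> z \in (`[0, +oo[%classic : set R).
  by move=> z0; rewrite inE/= in_itv/= z0.
move=> /(_ (in0 x x0) (in0 y y0)); rewrite !convRE => h.
have {h} : (2^-1 * x + (1 - 2^-1) * y) `^ gamma <=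
  2^-1 * x `^ gamma + (1 - 2^-1) * y `^ gamma by exact: h.
have -> : 2^-1 * x + (1 - 2^-1) * y = (x + y) / 2 by field.
lra.
Qed.

(** Midpoint convexity of the power x^gamma at three consecutive nodes. *)
Lemma mesh_step_le n : t n.+1 - t n <= t n.+2 - t n.+1.
Proof.
rewrite /mesh -!mulrBl ler_pM2r//.
have := @powR_midpoint (n%:R / N%:R) (n.+2%:R / N%:R).
rewrite !divr_ge0// => /(_ isT isT).
have -> : (n%:R / N%:R + n.+2%:R / N%:R) / 2 = n.+1%:R / N%:R :> R.
  by rewrite -[n.+2]addn2 -[n.+1]addn1 !natrD; field; rewrite gt_eqF.
lra.
Qed.

End graded_mesh.

(** * Energy estimate *)

Section H1_space.
Context {R : realType} {d : nat} (Om : set 'cV[R]_d).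

Lemma sqr_normH1 (phi : fgrad R d) : normH1 Om phi ^+ 2 =
  normL2 Om phi.1 ^+ 2 + \sum_(i < d) normL2 Om (fun x => phi.2 x i 0) ^+ 2.
Proof.
by rewrite sqr_sqrtr// addr_ge0 ?sqr_ge0// sumr_ge0// => i _; exact: sqr_ge0.
Qed.

Lemma normH1_ge0 (phi : fgrad R d) : 0 <= normH1 Om phi.
Proof. exact: sqrtr_ge0. Qed.

Lemma sqr_normL2_le_normH1 (phi : fgrad R d) :
  normL2 Om phi.1 ^+ 2 <= normH1 Om phi ^+ 2.
Proof.
by rewrite sqr_normH1 lerDl sumr_ge0// => i _; exact: sqr_ge0.
Qed.

Variable Sh : set (fgrad R d).
Hypothesis hSh : findim_subspace_H01 Om Sh.

Lemma Sh_comb (a : R) phi psi : Sh phi -> Sh psi -> Sh (a *: phi + psi).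
Proof. by case: hSh => _ _ h _; exact: h. Qed.

Lemma Sh_sub phi psi : Sh phi -> Sh psi -> Sh (phi - psi).
Proof. by move=> h1 h2; rewrite addrC -scaleN1r; exact: Sh_comb. Qed.

Lemma Sh_scale (a : R) phi : Sh phi -> Sh (a *: phi).
Proof. by move=> h; rewrite -[_ *: _]addr0; apply: Sh_comb => //; case: hSh. Qed.

Lemma Sh_H01 phi : Sh phi -> inH01 Om phi.
Proof. by case: hSh => h _ _ _; exact: h. Qed.

Lemma Sh_H1 phi : Sh phi -> inH1 Om phi.
Proof. by move=> /Sh_H01[]. Qed.

Lemma Sh_L2 phi : Sh phi -> inL2 Om phi.1.
Proof. by move=> /Sh_H1[]. Qed.

Lemma Sh_L1_caputo (t : nat -> R) alpha (u : nat -> fgrad R d) n :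
  (forall j, (j <= n)%N -> Sh (u j)) -> Sh (L1_caputo t alpha u n).
Proof.
move=> hu; rewrite /L1_caputo big_nat; apply: (big_rec Sh).
  by case: hSh.
move=> j phi /andP[j1 jn] hphi; apply: Sh_comb => //.
by apply: Sh_sub; apply: hu => //; rewrite (leq_trans (leq_pred _)).
Qed.

End H1_space.

Section discrete_energy.
Context {R : realType} {d : nat} (Om : set 'cV[R]_d).
Hypothesis mOm : measurable Om.
Variables (A : 'cV[R]_d -> R -> 'M[R]_d) (b : 'cV[R]_d -> R -> 'cV[R]_d)
  (c : 'cV[R]_d -> R -> R) (T : R).
Hypothesis hcoef : coefficients Om A b c T.
Variable Sh : set (fgrad R d).
Hypothesis hSh : findim_subspace_H01 Om Sh.
Variables (t : nat -> R) (alpha : R).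
Hypothesis t0 : t 0%N = 0.
Hypothesis tS : forall n, t n < t n.+1.
Hypothesis alpha01 : 0 < alpha < 1.
Variable u : nat -> fgrad R d.
Variable n : nat.
Hypothesis n0 : (0 < n)%N.
Hypothesis tn : 0 < t n <= T.
Hypothesis uSh : forall j, (j <= n)%N -> Sh (u j).
Local Notation a0 := (form_a0 Om A).
Local Notation K := (L1_coef t alpha).

Let uH1 j : (j <= n)%N -> inH1 Om (u j).
Proof. by move=> jn; apply: Sh_H1 (uSh jn). Qed.

Lemma form_a0_caputo :
  a0 (t n) (u n) (L1_caputo t alpha u n) =
  winc (K n) (fun j => a0 (t n) (u n) (u j)) n.
Proof.
suff h m : (m <= n)%N ->
    Sh (\sum_(1 <= j < m.+1) K n j *: (u j - u j.-1)) /\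
    a0 (t n) (u n) (\sum_(1 <= j < m.+1) K n j *: (u j - u j.-1)) =
    winc (K n) (fun j => a0 (t n) (u n) (u j)) m by have [] := h n (leqnn n).
have lin := form_a0_linear mOm hcoef.
elim: m => [_|m IH mn].
  rewrite winc0 big_geq//; split; first by case: hSh.
  have S0 : Sh 0 by case: hSh.
  have := lin _ (-1) (u n) 0 0 tn (uH1 (leqnn n)) (Sh_H1 hSh S0) (Sh_H1 hSh S0).
  by rewrite scaler0 addr0 mulN1r addNr.
have [Sm Em] := IH (ltnW mn).
rewrite big_nat_recr//= addrC; split.
  by apply: (Sh_comb hSh) => //; apply: (Sh_sub hSh); apply: uSh => //; exact: ltnW.
have Su := uSh mn; have Su' := uSh (ltnW mn).
have Hn := uH1 (leqnn n).
rewrite (lin _ _ _ _ _ tn Hn (Sh_H1 hSh (Sh_sub hSh Su Su')) (Sh_H1 hSh Sm)).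
rewrite Em wincS addrC; congr (_ + _ * _).
rewrite -/(a0 (t n) (u n) (u m.+1)) [u m.+1 - _]addrC -scaleN1r.
by rewrite (lin _ _ _ _ _ tn Hn (Sh_H1 hSh Su') (Sh_H1 hSh Su)) mulN1r addrC.
Qed.

Hypothesis a0_ge0 : forall phi, inH01 Om phi -> 0 <= a0 (t n) phi phi.

(** Nonnegativity of the form at phi - psi. *)
Lemma form_a0_polar phi psi : Sh phi -> Sh psi ->
  2 * a0 (t n) phi psi <= a0 (t n) phi phi + a0 (t n) psi psi.
Proof.
move=> Sphi Spsi; have lin := form_a0_linear mOm hcoef.
have Sd := Sh_sub hSh Sphi Spsi.
have h1 := Sh_H1 hSh Sphi; have h2 := Sh_H1 hSh Spsi; have h3 := Sh_H1 hSh Sd.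
have sym := form_a0_sym mOm hcoef tn.
have E chi : inH1 Om chi -> a0 (t n) chi (phi - psi) = a0 (t n) chi phi - a0 (t n) chi psi.
  by move=> hchi; rewrite addrC -scaleN1r lin// mulN1r addrC.
have := a0_ge0 (Sh_H01 hSh Sd).
rewrite E// (sym (phi - psi) phi)// (sym (phi - psi) psi)// !E//.
by rewrite (sym psi phi)//; lra.
Qed.

(** The discrete counterpart of 2 a0(u, u') = (a0(u, u))': compare
    2 a0(u^n, u^j) with a0(u^n, u^n) + a0(u^j, u^j), with equality at j = n, and
    use that discrete differentiation is monotone in this situation. *)
Lemma form_a0_caputo_ge :
  winc (K n) (fun j => a0 (t n) (u j) (u j)) n <=
  2 * a0 (t n) (u n) (L1_caputo t alpha u n).
Proof.
rewrite form_a0_caputo -wincZ.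
set q := fun j => a0 (t n) (u j) (u j).
suff : winc (K n) (fun j => q n + q j) n <=
       winc (K n) (fun j => 2 * a0 (t n) (u n) (u j)) n.
  by rewrite wincD winc_cst add0r.
apply: winc_le => //.
- exact: L1_coef_ge0.
- by move=> j; exact: L1_coef_nd.
- by rewrite /q; lra.
- by move=> j jn; apply: form_a0_polar; apply: uSh => //; exact: ltnW.
Qed.

Variables (beta0 L : R).
Hypothesis beta0_gt0 : 0 < beta0.
Hypothesis L_ge0 : 0 <= L.
Hypothesis tT : forall j, (j <= n)%N -> 0 <= t j <= T.
Hypothesis coercive : forall (s : R) (phi : fgrad R d), 0 <= s <= T -> inH01 Om phi ->
    beta0 * normH1 Om phi ^+ 2 <= a0 s phi phi.
Hypothesis lipschitz : forall (s r : R) (phi : fgrad R d), 0 <= s <= T -> 0 <= r <= T ->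
    inH01 Om phi ->
    `|a0 s phi phi - a0 r phi phi| <= L * `|s - r| * normH1 Om phi ^+ 2.
Let q j := a0 (t j) (u j) (u j).

Lemma energy_coercive j : (j <= n)%N -> normH1 Om (u j) ^+ 2 <= q j / beta0.
Proof.
move=> jn; rewrite ler_pdivlMr// mulrC; apply: coercive; first exact: tT.
by apply: Sh_H01 hSh _ _; exact: uSh.
Qed.

(** The energy at time t_n of an older iterate u^j exceeds the one at time t_j by
    at most L (t_n - t_j) m / beta0, a linear function of t_j that vanishes at
    j = n; the discrete derivative of that function is explicit. *)
Lemma energy_frozen_time (m : R) : (forall j, (j <= n)%N -> q j <= m) ->
  winc (K n) q n <=
  winc (K n) (fun j => a0 (t n) (u j) (u j)) n +
  L * m / beta0 * kker (2 - alpha) (t n).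
Proof.
move=> qm; set cst := L * m / beta0.
rewrite -(sum_L1_coef_step t0 tS alpha01) -wincZ -wincD.
suff : winc (K n) q n <=
   winc (K n) (fun j => (a0 (t n) (u j) (u j) + cst * t j) + (- cst * t n)) n.
  by rewrite wincD winc_cst addr0.
apply: winc_le => //.
- exact: L1_coef_ge0.
- by move=> j; exact: L1_coef_nd.
- by rewrite /q; lra.
move=> j /ltnW jn; have uj := Sh_H01 hSh (uSh jn).
have := lipschitz (tT (leqnn n)) (tT jn) uj.
have tjn : t j <= t n by exact: node_le.
rewrite [X in L * X]ger0_norm ?subr_ge0// => /(le_trans (ler_norm _)).
have : normH1 Om (u j) ^+ 2 <= m / beta0.
  by apply: le_trans (energy_coercive jn) _; rewrite ler_pM2r ?invr_gt0// qm.
move=> h1 h2.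
have : L * (t n - t j) * normH1 Om (u j) ^+ 2 <= L * (t n - t j) * (m / beta0).
  by rewrite ler_wpM2l// mulr_ge0// subr_ge0.
have -> : L * (t n - t j) * (m / beta0) = cst * (t n - t j) by rewrite /cst; ring.
by rewrite /q; lra.
Qed.

End discrete_energy.

Section extrapolation_bound.
Context {R : realType} {d : nat} (Om : set 'cV[R]_d).
Hypothesis mOm : measurable Om.

(** The constant in the stability bound of the extrapolation operator, which is
    how the two cases of [Lambda1] differ. *)
Definition extrapolation_factor (s : scheme) (mu : R) : R :=
  match s with
  | FullyImplicit => 1
  | IMEX => 2 * ((1 + mu) ^+ 2 + mu ^+ 2)
  end.

Lemma extrapolation_normL2 (t : nat -> R) (s : scheme) (mu m : R)
    (u : nat -> fgrad R d) n :
  0 <= mu -> ((1 < n)%N -> 0 <= step_ratio t n <= mu) ->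
  (forall j, (j <= n)%N -> inL2 Om (u j).1) ->
  (forall j, (j <= n)%N -> normL2 Om (u j).1 ^+ 2 <= m) ->
  normL2 Om (extrapolation t s u n).1 ^+ 2 <= extrapolation_factor s mu * m.
Proof.
move=> mu0 ratio u2 um; have m0 : 0 <= m by apply: le_trans (um n (leqnn n)); exact: sqr_ge0.
case: s => /=; first by rewrite mul1r; exact: um.
have [n1|n1] := leqP n 1.
  apply: le_trans (um 0%N (leq0n n)) _; rewrite ler_peMl//.
  by have := sqr_ge0 mu; nra.
have /andP[r0 rmu] := ratio n1.
set r := step_ratio t n in r0 rmu *.
have n1' : (n.-1 <= n)%N by exact: leq_pred.
have n2' : (n.-2 <= n)%N by rewrite (leq_trans (leq_pred _)).
have -> : ((1 + r) *: u n.-1 - r *: u n.-2).1 =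
    (fun x => (1 + r) * (u n.-1).1 x - r * (u n.-2).1 x) by [].
apply: le_trans (sqr_normL2_sub_le mOm _ _ (u2 _ n1') (u2 _ n2')) _.
rewrite -mulrA ler_pM2l// mulrDl lerD//; apply: ler_pM; rewrite ?sqr_ge0 ?um//.
  by rewrite lerXn2r ?nnegrE ?addr_ge0 ?lerD2l// (le_trans r0).
by rewrite lerXn2r ?nnegrE// (le_trans r0).
Qed.

Lemma extrapolation_in (Sh : set (fgrad R d)) (t : nat -> R) (s : scheme)
    (u : nat -> fgrad R d) n : findim_subspace_H01 Om Sh ->
  (forall j, (j <= n)%N -> Sh (u j)) -> Sh (extrapolation t s u n).
Proof.
move=> hSh uSh; case: s => /=; first exact: uSh.
case: ifP => _; first exact: uSh.
apply: (Sh_sub hSh); apply: (Sh_scale hSh); apply: uSh.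
  exact: leq_pred.
by rewrite (leq_trans (leq_pred _))// leq_pred.
Qed.

End extrapolation_bound.

(** The three products with X are absorbed by X^2 with the shares 1/4, 1/4 and
    1/2.  Here X is the norm of the discrete derivative, S stands for the
    discrete derivative of the energies, and a0, a1, ip, fip are the terms of
    the tested equation. *)
Lemma energy_young {R : realFieldType} (X S U P f beta1 lam a0 a1 ip fip : R) :
  0 <= X -> 
  X ^+ 2 + (a0 + a1) = lam * ip + fip -> S <= 2 * a0 ->
  `|a1| <= beta1 * U * X -> `|ip| <= P * X -> `|fip| <= f * X ->
  S <= 2 * (beta1 ^+ 2 * U ^+ 2 + lam ^+ 2 * P ^+ 2) + f ^+ 2.
Proof.
move=> X0 E Sa; rewrite ler_norml => /andP[a1l _] ipl fipl.
have : lam * ip <= `|lam| * P * X.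
  rewrite -mulrA; apply: le_trans (ler_norm _) _.
  by rewrite normrM ler_wpM2l.
have := le_trans (ler_norm _) fipl.
have -> : lam ^+ 2 = `|lam| ^+ 2 by rewrite real_normK// num_real.
have := sqr_ge0 (X / 2 - beta1 * U).
have := sqr_ge0 (X / 2 - `|lam| * P).
have := sqr_ge0 (X - f).
by nra.
Qed.

(** The Gronwall bound is linear in E while the square of the announced bound is
    quadratic in it, so E >= 1 leaves enough room for the constants. *)
Lemma final_estimate {R : realType} (U2 E q0 u02 Fm TA k g0 b0 C : R) :
  1 <= E -> 0 < b0 -> 0 <= Fm -> 0 <= u02 -> 0 <= TA -> 0 <= C ->
  g0 / b0 <= C ^+ 2 -> 2 * TA / b0 <= C ^+ 2 -> k <= 4 * TA ->
  q0 <= g0 * u02 ^+ 2 ->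
  U2 <= E * (q0 + 2 * Fm ^+ 2 * k) / b0 ->
  U2 <= (2 * C * E * (u02 + Fm)) ^+ 2.
Proof.
move=> E1 b00 Fm0 u0 TA0 C0 h1 h2 hk hq /le_trans; apply.
have E0 : 0 <= E by lra.
rewrite -mulrA; apply: (@le_trans _ _ (E * (C ^+ 2 * u02 ^+ 2 + 4 * C ^+ 2 * Fm ^+ 2))).
  rewrite ler_wpM2l// mulrDl lerD//.
    apply: (@le_trans _ _ (g0 / b0 * u02 ^+ 2)); last by rewrite ler_wpM2r ?sqr_ge0.
    by rewrite mulrAC ler_pM2r ?invr_gt0.
  apply: (@le_trans _ _ (4 * (2 * TA / b0) * Fm ^+ 2)); last first.
    by rewrite ler_wpM2r ?sqr_ge0// ler_wpM2l.
  have -> : 4 * (2 * TA / b0) * Fm ^+ 2 = 2 * Fm ^+ 2 * (4 * TA) / b0 by ring.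
  by rewrite ler_pM2r ?invr_gt0// ler_wpM2l// mulr_ge0 ?sqr_ge0.
have -> : (2 * C * E * (u02 + Fm)) ^+ 2 = E * (E * (4 * C ^+ 2 * (u02 + Fm) ^+ 2)) by ring.
rewrite ler_wpM2l//.
apply: (@le_trans _ _ (4 * C ^+ 2 * (u02 + Fm) ^+ 2)); last first.
  by rewrite ler_peMl// mulr_ge0 ?sqr_ge0// mulr_ge0 ?sqr_ge0.
have C2 : 0 <= C ^+ 2 by exact: sqr_ge0.
have : 0 <= C ^+ 2 * (u02 * Fm) by rewrite !mulr_ge0.
have : 0 <= C ^+ 2 * u02 ^+ 2 by rewrite !mulr_ge0 ?sqr_ge0.
nra.
Qed.

Theorem theorem3p3 (R : realType) (d : nat) (hd : (1 <= d <= 3)%N)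
  (Om : set 'cV[R]_d) (hOm : convex_polytopal_domain Om)
  (alpha T lambda : R) (halpha : 0 < alpha < 1) (hT : 0 < T)
  (g : 'cV[R]_d * 'cV[R]_d -> R) (hg : inLinf2 Om g)
  (beta2 : R)
  (hbeta2 : forall phi : 'cV[R]_d -> R, inL2 Om phi ->
    normL2 Om (int_op Om g phi) <= beta2 * normL2 Om phi)
  (A : 'cV[R]_d -> R -> 'M[R]_d) (b : 'cV[R]_d -> R -> 'cV[R]_d)
  (c : 'cV[R]_d -> R -> R) (hcoef : coefficients Om A b c T)
  (gamma0 beta0 beta1 L : R)
  (hgamma0 : 0 < gamma0) (hbeta0 : 0 < beta0) (hbeta1 : 0 < beta1) (hL : 0 < L)
  (ha0_bounded : forall (t : R) (phi psi : fgrad R d), 0 <= t <= T -> inH01 Om phi -> inH01 Om psi ->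
    `|form_a0 Om A t phi psi| <= gamma0 * normH1 Om phi * normH1 Om psi)
  (ha0_coercive : forall (t : R) (phi : fgrad R d), 0 <= t <= T -> inH01 Om phi ->
    beta0 * normH1 Om phi ^+ 2 <= form_a0 Om A t phi phi)
  (ha0_lipschitz : forall (t s : R) (phi : fgrad R d), 0 <= t <= T -> 0 <= s <= T -> inH01 Om phi ->
    `|form_a0 Om A t phi phi - form_a0 Om A s phi phi|
      <= L * `|t - s| * normH1 Om phi ^+ 2)
  (ha1_bounded : forall (t : R) (phi psi : fgrad R d), 0 < t <= T -> inH01 Om phi -> inH01 Om psi ->
    `|form_a1 Om b c t phi psi| <= beta1 * normH1 Om phi * normL2 Om psi.1)
  (N : nat) (hN : (1 < N)%N) (gamma : R) (hgamma : 1 <= gamma)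
  (u0 : 'cV[R]_d -> R) (hu0 : inL2 Om u0)
  (f : R -> 'cV[R]_d -> R)
  (hf : forall n, (1 <= n <= N)%N -> inL2 Om (f (mesh T gamma N n)))
  (Sh : set (fgrad R d)) (hSh : findim_subspace_H01 Om Sh)
  (meth : scheme) :
  let t := mesh T gamma N in
  let Lam := Lambda1 meth alpha T lambda beta0 beta1 beta2 L (max_ratio t N) in
  max_step t N < (1 / (2 * Lam * Gamma (2 - alpha))) `^ (1 / alpha) ->
  forall uh : nat -> fgrad R d,
  is_L2_projection Om Sh u0 (uh 0%N) ->
  (forall n, (1 <= n <= N)%N -> Sh (uh n)) ->
  (forall n, (1 <= n <= N)%N -> forall vh, Sh vh ->
    ipL2 Om (L1_caputo t alpha uh n).1 vh.1 + form_a Om A b c (t n) (uh n) vh =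
    lambda * ipL2 Om (int_op Om g (extrapolation t meth uh n).1) vh.1
    + ipL2 Om (f (t n)) vh.1) ->
  forall n, (1 <= n <= N)%N ->
  normH1 Om (uh n) <=
    2 * C1 alpha T gamma0 beta0 * mittag_leffler alpha (2 * Lam * t n `^ alpha) *
    (normH1 Om (uh 0%N) +
     \big[Num.max/0]_(1 <= j < n.+1) normL2 Om (f (t j))).
Proof.
move=> t Lam hstep uh [Sh0 _] ShN heq n /andP[n_gt0 nN].
have [alpha0 alpha1] := andP halpha.
have mOm := polytope_measurable hOm.
have Omoo := polytope_lebesgue_lty hOm.
have N0 : (0 < N)%N by exact: ltnW.
have t0 : t 0%N = 0 by apply: mesh0 => //; exact: lt_le_trans hgamma.
have tS k : t k < t k.+1 by exact: mesh_lt.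
have tStep k : t k.+1 - t k <= t k.+2 - t k.+1 by exact: mesh_step_le.
have tT k : (k <= N)%N -> 0 <= t k <= T by exact: mesh_le.
have tT' k : (0 < k <= N)%N -> 0 < t k <= T.
  move=> /andP[k0 kN]; rewrite (node_gt0 t0 tS k0)/=.
  by have /andP[] := tT k kN.
have uSh k : (k <= N)%N -> Sh (uh k).
  by case: k => // k kN; apply: ShN.
pose q j := form_a0 Om A (t j) (uh j) (uh j).
have q_ge0 j : (j <= N)%N -> 0 <= q j.
  move=> jN; apply: le_trans (ha0_coercive _ _ (tT j jN) (Sh_H01 hSh (uSh j jN))).
  by rewrite mulr_ge0 ?sqr_ge0// ltW.
set mu := max_ratio t N.
set Fm := \big[Num.max/0]_(1 <= j < n.+1) normL2 Om (f (t j)).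
have Fm0 : 0 <= Fm by exact: bigmax_ge_id.
have G2 : 0 < Gamma (2 - alpha) by rewrite Gamma_gt0// subr_gt0 (lt_trans alpha1)// ltr1n.
have mu0 : 0 <= mu by exact: bigmax_ge_id.
pose kap := extrapolation_factor meth mu.
have LamE : Lam = 2 * ((beta1 ^+ 2 + lambda ^+ 2 * beta2 ^+ 2 * kap) / beta0) +
    L * T `^ (1 - alpha) / (beta0 * Gamma (2 - alpha)).
  rewrite /Lam /Lambda1 /kap /extrapolation_factor; case: (meth); first by rewrite mulr1.
  by congr (_ * (_ / _) + _); rewrite -/mu; ring.
have kap0 : 0 <= kap.
  by rewrite /kap; case: (meth) => //=; rewrite mulr_ge0// addr_ge0// sqr_ge0.
have Lam_gt0 : 0 < Lam.
  rewrite LamE ltr_wpDl ?divr_gt0 ?mulr_gt0 ?powR_gt0//.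
  rewrite mulr_ge0// divr_ge0 ?(ltW hbeta0)// addr_ge0 ?sqr_ge0//.
  by rewrite mulr_ge0// mulr_ge0 ?sqr_ge0.
have hdiag k : (0 < k <= n)%N -> 2 * Lam <= L1_coef t alpha k k.
  move=> /andP[k0 kn]; rewrite (L1_coef_diag tS halpha k0).
  have tau0 := step_gt0 tS k0.
  have : step_size t k < (1 / (2 * Lam * Gamma (2 - alpha))) `^ (1 / alpha).
    apply: le_lt_trans hstep; apply: (le_bigmax_seq _ k xpredT (fun j => step_size t j)) => //.
    by rewrite mem_index_iota k0 ltnS (leq_trans kn).
  have LG : 0 < 2 * Lam * Gamma (2 - alpha) by rewrite !mulr_gt0.
  rewrite div1r => /(@gt0_ltr_powR _ _ alpha0 _ _).
  rewrite !nnegrE powR_ge0 (ltW tau0) => /(_ isT isT).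
  rewrite -powRrM mul1r mulVf ?gt_eqF// powRr1 ?invr_ge0 ?(ltW LG)// => h.
  rewrite -[leLHS]invrK lef_pV2 ?posrE ?invr_gt0 ?mulr_gt0 ?powR_gt0//.
  move: h; rewrite invfM => h.
  apply: ltW; rewrite mulrC -ltr_pdivlMr//.
have henergy k : (0 < k <= n)%N ->
    winc (L1_coef t alpha k) q k <= Lam * running_max q k + Fm ^+ 2.
  move=> /andP[k0 kn]; have kN := leq_trans kn nN; have k0N : (0 < k <= N)%N by rewrite k0.
  set m := running_max q k.
  have uShk j : (j <= k)%N -> Sh (uh j) by move=> jk; apply: uSh; exact: leq_trans kN.
  have tTk j : (j <= k)%N -> 0 <= t j <= T by move=> jk; apply: tT; exact: leq_trans kN.
  have qm j : (j <= k)%N -> q j <= m by exact: running_max_ge.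
  have m0 : 0 <= m by apply: le_trans (qm 0%N (leq0n k)); exact: q_ge0.
  have um j : (j <= k)%N -> normH1 Om (uh j) ^+ 2 <= m / beta0.
    move=> jk; apply: le_trans (energy_coercive hSh uShk hbeta0 tTk ha0_coercive jk) _.
    by rewrite ler_pM2r ?invr_gt0//; exact: qm.
  have frozen := energy_frozen_time hSh t0 tS halpha k0 uShk hbeta0 (ltW hL) tTk
    ha0_coercive ha0_lipschitz qm.
  have a0pos phi : inH01 Om phi -> 0 <= form_a0 Om A (t k) phi phi.
    move=> hphi; apply: le_trans (ha0_coercive _ _ (tT k kN) hphi).
    by rewrite mulr_ge0 ?sqr_ge0// ltW.
  have caputo := form_a0_caputo_ge mOm hcoef hSh tS halpha k0 (tT' k k0N) uShk a0pos.
  set D := L1_caputo t alpha uh k in caputo.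
  have ShD : Sh D := Sh_L1_caputo hSh t alpha uShk.
  have ShE : Sh (extrapolation t meth uh k) by exact: (extrapolation_in t meth hSh uShk).
  have Eq := heq k k0N D ShD.
  rewrite /form_a -/D -sqr_normL2 in Eq.
  have D2 := Sh_L2 hSh ShD; have E2 := Sh_L2 hSh ShE.
  have IE2 := int_op_inL2 mOm Omoo hg E2.
  have young := energy_young (normL2_ge0 Om D.1) Eq caputo
    (ha1_bounded _ _ _ (tT' k k0N) (Sh_H01 hSh (uSh k kN)) (Sh_H01 hSh ShD))
    (ipL2_cauchy_schwarz mOm IE2 D2)
    (ipL2_cauchy_schwarz mOm (hf k k0N) D2).
  apply: le_trans frozen _; rewrite LamE.
  have h1 : beta1 ^+ 2 * normH1 Om (uh k) ^+ 2 <= beta1 ^+ 2 * (m / beta0).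
    by rewrite ler_wpM2l ?sqr_ge0// um.
  have h2 : normL2 Om (int_op Om g (extrapolation t meth uh k).1) ^+ 2 <=
      beta2 ^+ 2 * (kap * (m / beta0)).
    apply: (@le_trans _ _ ((beta2 * normL2 Om (extrapolation t meth uh k).1) ^+ 2)).
      have hb := hbeta2 _ E2.
      rewrite lerXn2r ?nnegrE ?normL2_ge0//.
      by apply: le_trans hb; exact: normL2_ge0.
    rewrite exprMn ler_wpM2l ?sqr_ge0//.
    apply: extrapolation_normL2 => //.
    - move=> k1; apply/andP; split.
        by rewrite divr_ge0// ltW// (step_gt0 tS)//; case: (k) k1 => [|[]].
      apply: (le_bigmax_seq _ k xpredT (fun j => step_ratio t j)) => //.
      by rewrite mem_index_iota k1 ltnS.
    - by move=> j jk; apply: (Sh_L2 hSh); exact: uShk.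
    - by move=> j jk; apply: le_trans (sqr_normL2_le_normH1 _ _) (um j jk).
  have h3 : normL2 Om (f (t k)) ^+ 2 <= Fm ^+ 2.
    rewrite lerXn2r ?nnegrE ?normL2_ge0//.
    apply: (le_bigmax_seq _ k xpredT (fun j => normL2 Om (f (t j)))) => //.
    by rewrite mem_index_iota k0.
  have h4 : kker (2 - alpha) (t k) <= T `^ (1 - alpha) / Gamma (2 - alpha).
    have /andP[tk0 tkT] := tT k kN.
    rewrite /kker ler_pM2r ?invr_gt0// (_ : 2 - alpha - 1 = 1 - alpha); last by ring.
    apply: ge0_ler_powR => //; rewrite ?nnegrE ?(ltW hT)// subr_ge0; exact: ltW.
  have h5 : L * m / beta0 * kker (2 - alpha) (t k) <=
      L * m / beta0 * (T `^ (1 - alpha) / Gamma (2 - alpha)).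
    by rewrite ler_wpM2l// divr_ge0 ?mulr_ge0 ?(ltW hL) ?(ltW hbeta0).
  have h6 : lambda ^+ 2 * normL2 Om (int_op Om g (extrapolation t meth uh k).1) ^+ 2 <=
      lambda ^+ 2 * (beta2 ^+ 2 * (kap * (m / beta0))).
    by rewrite ler_wpM2l ?sqr_ge0.
  rewrite [leRHS](_ : _ = 2 * (beta1 ^+ 2 * (m / beta0) +
      lambda ^+ 2 * (beta2 ^+ 2 * (kap * (m / beta0)))) + Fm ^+ 2 +
      L * m / beta0 * (T `^ (1 - alpha) / Gamma (2 - alpha))); last first.
    by field; rewrite !gt_eqF.
  apply: lerD => //; apply: le_trans young _.
  by rewrite lerD// ler_pM2l// lerD.
have := L1_gronwall t0 tS tStep halpha (ltW Lam_gt0) (sqr_ge0 Fm) (q_ge0 _ (leq0n N)) hdiag henergy.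
set E := mittag_leffler _ _ => hq.
have E1 : 1 <= E by apply: mittag_leffler_ge1 => //; rewrite !mulr_ge0 ?powR_ge0// ltW.
have C0 : 0 <= C1 alpha T gamma0 beta0 by rewrite /C1 le_max sqrtr_ge0.
(* everything above bounds squares of norms *)
rewrite -(@ler_sqr R) ?nnegrE ?normH1_ge0//; last first.
  by rewrite !mulr_ge0// ?addr_ge0 ?normH1_ge0//; lra.
apply: (@final_estimate R _ E (q 0%N) _ Fm (T `^ alpha) (kker (alpha + 1) (t n)) gamma0 beta0) => //.
- exact: normH1_ge0.
- exact: powR_ge0.
- rewrite -[leLHS]sqr_sqrtr ?divr_ge0 ?(ltW hgamma0) ?(ltW hbeta0)//.
  by rewrite lerXn2r ?nnegrE ?sqrtr_ge0// /C1 le_max lexx.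
- rewrite -[leLHS]sqr_sqrtr ?divr_ge0 ?mulr_ge0 ?powR_ge0 ?(ltW hbeta0)//.
  by rewrite lerXn2r ?nnegrE ?sqrtr_ge0// /C1 le_max lexx orbT.
- have /andP[tn0 tnT] := tT n nN.
  rewrite /kker addrK mulrC; apply: ler_pM; rewrite ?powR_ge0 ?invr_ge0 ?(ltW (Gamma_gt0 _)) ?addr_gt0//.
    rewrite -[leRHS]invrK lef_pV2 ?posrE ?invr_gt0 ?Gamma_gt0 ?addr_gt0//.
    exact/Gamma_ge_quarter/ltW.
  by apply: ge0_ler_powR => //; rewrite ?nnegrE ?(ltW hT)// ltW.
- have := ha0_bounded _ _ _ (tT 0%N (leq0n N)) (Sh_H01 hSh Sh0) (Sh_H01 hSh Sh0).
  by rewrite -mulrA -expr2; apply: le_trans; exact: ler_norm.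
- rewrite ler_pdivlMr// mulrC; apply: le_trans hq.
  exact: ha0_coercive (tT n nN) (Sh_H01 hSh (uSh n nN)).
Qed.
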